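(* Let $2<p, q<\infty$ and $p \neq q$. Then there exists a closed subspace $Y\subset\ell^q$ such that $Y$ fails to have the uniform $\mathcal{QN}_p$-approximation property, and a closed subspace $X \subset \ell^p$ for which \[ \mathcal A(X,Y) \subsetneq \mathcal K(X,Y). \]
   Context: $\mathcal K(X,Y)$ denotes the compact operators $X\to Y$, and $\mathcal A(X,Y)=\overline{\mathcal F(X,Y)}$ the operator norm closure of the bounded finite-rank operators $X\to Y$. Quasi $p$-nuclear operators: for $1\le p<\infty$, a bounded operator $U:X\to Y$ between Banach spaces belongs to $\mathcal{QN}_p(X,Y)$ if there is a strongly $p$-summable sequence $(x_j^* )\subset X^*$ (that is, $\sum_j\|x_j^*\|^p<\infty$) such that $\|Ux\|\le\big(\sum_{j=1}^\infty|x_j^*(x)|^p\big)^{1/p}$ for all $x\in X$. Every quasi $p$-nuclear operator is compact. Uniform $\mathcal I$-approximation property: for a Banach operator ideal $\mathcal I$ contained in the compact operators, the Banach space $X$ has the uniform $\mathcal I$-approximation property if $\mathcal I(Z,X)\subset\mathcal A(Z,X)$ for all Banach spaces $Z$. *)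

(* Defs.v *)
From HB Require Import structures.
From mathcomp Require Import all_boot all_order all_algebra.
From mathcomp Require Import complex.
From mathcomp Require Import all_classical all_reals all_analysis.

Set Implicit Arguments.
Unset Strict Implicit.
Unset Printing Implicit Defensive.

Import Order.TTheory GRing.Theory Num.Theory.
Import numFieldNormedType.Exports.

Local Open Scope classical_set_scope.
Local Open Scope ring_scope.

Variant scalar_kind := RealScalars | ComplexScalars.

Definition scalars (R : realType) (k : scalar_kind) : numFieldType :=
  match k with
  | RealScalars => R
  | ComplexScalars => R[i]
  end.

Definition sRe {R : realType} {k : scalar_kind} : scalars R k -> R :=
  match k with
  | RealScalars => fun x : R => x
  | ComplexScalars => fun z : R[i] => complex.Re z
  end.

(* Identically 0 for real scalars. *)
Definition sIm {R : realType} {k : scalar_kind} : scalars R k -> R :=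
  match k with
  | RealScalars => fun=> 0
  | ComplexScalars => fun z : R[i] => complex.Im z
  end.

Definition sofR {R : realType} (k : scalar_kind) : R -> scalars R k :=
  match k with
  | RealScalars => fun r : R => r
  | ComplexScalars => fun r : R => r%:C%C
  end.

(* In a normedModType K the norm takes its values in K, here possibly R[i];
   rnorm is the same norm with its (nonnegative real) value read in R. *)
Definition rnorm {R : realType} {k : scalar_kind}
  {V : normedModType (scalars R k)} (v : V) : R := sRe `|v|.

Section Scalars.
Context {R : realType} {k : scalar_kind}.
Local Notation K := (scalars R k).

Lemma sReB (x y : K) : sRe (x - y) = sRe x - sRe y.
Proof. by case: k x y => //= -[a b] [c d]. Qed.
Lemma sImB (x y : K) : sIm (x - y) = sIm x - sIm y.
Proof. by case: k x y => [|[a b] [c d]//] /= *; rewrite subr0. Qed.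
Lemma sReD (x y : K) : sRe (x + y) = sRe x + sRe y.
Proof. by case: k x y => //= -[a b] [c d]. Qed.
Lemma sofRD (a b : R) : sofR k (a + b) = sofR k a + sofR k b.
Proof. by case: k => //=; rewrite rmorphD. Qed.
Lemma sofRM (a b : R) : sofR k (a * b) = sofR k a * sofR k b.
Proof. by case: k => //=; rewrite rmorphM. Qed.
Lemma sofR0 : sofR k (0 : R) = 0. Proof. by case: k. Qed.
Lemma sofRK (a : R) : sRe (sofR k a) = a. Proof. by case: k. Qed.
Lemma ler_sofR (a b : R) : (sofR k a <= sofR k b) = (a <= b).
Proof. by case: k => //=; rewrite lecR. Qed.
Lemma ltr_sofR (a b : R) : (sofR k a < sofR k b) = (a < b).
Proof. by case: k => //=; rewrite ltcR. Qed.
Lemma sReK (x : K) : 0 <= x -> sofR k (sRe x) = x.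
Proof. by case: k x => //= -[a b]; rewrite lecE /= => /andP[/eqP -> _]. Qed.
Lemma ler_sRe (x y : K) : x <= y -> sRe x <= sRe y.
Proof. by case: k x y => //= -[a b] [c d]; rewrite lecE /= => /andP[]. Qed.
Lemma ltr_sRe (x y : K) : x < y -> sRe x < sRe y.
Proof. by case: k x y => //= -[a b] [c d]; rewrite ltcE /= => /andP[]. Qed.
Lemma sReM (x y : K) : 0 <= x -> 0 <= y -> sRe (x * y) = sRe x * sRe y.
Proof.
by move=> x0 y0; rewrite -[in LHS](sReK x0) -[in LHS](sReK y0) -sofRM sofRK.
Qed.

Lemma sRe_norm_complex (z : R[i]) :
  sRe (`|z : scalars R ComplexScalars|) =
    Num.sqrt ((complex.Re z) ^+ 2 + (complex.Im z) ^+ 2).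
Proof. by case: z. Qed.

Lemma sRe_le_norm (x : K) : `|sRe x| <= sRe `|x|.
Proof.
case: k x => [//|z]; rewrite sRe_norm_complex -sqrtr_sqr ler_wsqrtr//.
by rewrite lerDl sqr_ge0.
Qed.
Lemma sIm_le_norm (x : K) : `|sIm x| <= sRe `|x|.
Proof.
case: k x => [/= x|z]; first by rewrite normr0 normr_ge0.
by rewrite sRe_norm_complex -sqrtr_sqr ler_wsqrtr// lerDr sqr_ge0.
Qed.
Lemma norm_le_sReIm (x : K) : sRe `|x| <= `|sRe x| + `|sIm x|.
Proof.
case: k x => [/= x|z]; first by rewrite normr0 addr0.
rewrite sRe_norm_complex -[leRHS]ger0_norm ?addr_ge0// -sqrtr_sqr.
rewrite ler_wsqrtr// sqrrD !real_normK ?num_real//.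
by rewrite -addrA [X in _ <= _ + X]addrC addrA lerDl mulrn_wge0// mulr_ge0.
Qed.

Definition smk (a b : R) : K :=
  match k with
  | RealScalars => a
  | ComplexScalars => (a +i* b)%C
  end.
Lemma sRe_smk a b : sRe (smk a b) = a. Proof. by rewrite /smk; case: k. Qed.
Lemma sIm_smk (x : K) a b : `|sIm x - sIm (smk a b)| <= `|sIm x - b|.
Proof. by rewrite /smk; case: k x => //= x; rewrite subrr normr0. Qed.

Context {V : normedModType K}.
Implicit Types v w : V.

Lemma rnormE v : `|v| = sofR k (rnorm v).
Proof. by rewrite sReK. Qed.
Lemma rnorm_ge0 v : 0 <= rnorm v.
Proof. by rewrite -ler_sofR sofR0 -rnormE. Qed.
Lemma rnormD v w : rnorm (v + w) <= rnorm v + rnorm w.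
Proof. by rewrite -sReD ler_sRe// ler_normD. Qed.
Lemma rnormN v : rnorm (- v) = rnorm v.
Proof. by rewrite /rnorm normrN. Qed.
Lemma rnormZ (a : K) v : rnorm (a *: v) = rnorm (a : K^o) * rnorm v.
Proof. by rewrite /rnorm normrZ sReM. Qed.
Lemma rnorm0_eq0 v : rnorm v = 0 -> v = 0.
Proof. by move=> v0; apply/eqP; rewrite -normr_eq0 rnormE v0 sofR0. Qed.
Lemma rnorm0 : rnorm (0 : V) = 0.
Proof. by rewrite /rnorm normr0 -sofR0 sofRK. Qed.

End Scalars.

Section ScalarsComplete.
Context {R : realType} {k : scalar_kind}.
Local Notation K := (scalars R k).

Lemma scalars_complete (F : set_system K) :
  ProperFilter F -> cauchy F -> cvg F.
Proof.
move=> FF /cauchy_ballP FC.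
have aux (h : K -> R) : (forall x y, h (x - y) = h x - h y) ->
    (forall x, `|h x| <= sRe `|x|) -> cvg (h @ F).
  move=> hB hle; apply: cauchy_cvg; apply/cauchy_ballP => e e0.
  have ke0 : 0 < sofR k e by rewrite -(sofR0 (k := k)) ltr_sofR.
  have := FC _ ke0; rewrite !near_simpl.
  case=> [[A B] [/= FA FB] AB].
  exists (h @` A, h @` B) => /=.
    split; rewrite /nbhs /= /fmap /=.
      by apply: filterS FA => x Ax; exists x.
    by apply: filterS FB => x Bx; exists x.
  move=> [_ _] [/= [x Ax <-] [y By <-]].
  have := AB (x, y) (conj Ax By).
  rewrite -!ball_normE /ball_ /= => xye.
  by rewrite -hB (le_lt_trans (hle _))// -(sofRK (k := k) e) ltr_sRe.
have /cvgrPdist_lt cRe := aux _ sReB sRe_le_norm.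
have /cvgrPdist_lt cIm := aux _ sImB sIm_le_norm.
set a := lim _ in cRe; set b := lim _ in cIm.
apply/cvg_ex; exists (smk a b : K); apply/cvgrPdist_lt => e e0.
have re0 : 0 < sRe e / 2 by rewrite divr_gt0// -(sofRK (k := k) 0) sofR0 ltr_sRe.
near=> x.
rewrite distrC -[`| _ |]sReK// -[ltRHS]sReK ?ltW// ltr_sofR.
rewrite (le_lt_trans (norm_le_sReIm _))// (splitr (sRe e)) ltrD//.
  by rewrite sReB sRe_smk distrC; near: x; exact: cRe.
rewrite sImB (le_lt_trans (sIm_smk _ _ _))// distrC.
by near: x; exact: cIm.
Unshelve. all: by end_near. Qed.

End ScalarsComplete.

(* The l^p norm (sum_n |x_n|^p)^(1/p), possibly +oo; see lnormE. *)
Definition lnorm {R : realType} {k : scalar_kind} (p : R)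
    (x : nat -> (scalars R k)^o) : \bar R :=
  Lnorm (@counting nat R) p%:E (fun n => (rnorm (x n))%:E).

Section Lnorm.
Context {R : realType} {k : scalar_kind}.
Local Notation K := (scalars R k).
Context {p : R} (p1 : 1 <= p).
Implicit Types x y : nat -> K^o.

Let p0 : 0 < p. Proof. exact: lt_le_trans p1. Qed.


Lemma lnormE x :
  lnorm p x = ((\sum_(n <oo) ((rnorm (x n)) `^ p)%:E) `^ p^-1)%E.
Proof.
rewrite /lnorm Lnorm_counting//; congr poweR.
by apply: eq_eseriesr => n _; rewrite gee0_abs ?lee_fin ?rnorm_ge0.
Qed.

Lemma lnorm_ge0 x : (0 <= lnorm p x)%E.
Proof. exact: Lnorm_ge0. Qed.

Let le_poweR (r : R) (a b : \bar R) : 0 <= r -> (0 <= a)%E -> (a <= b)%E ->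
  (a `^ r <= b `^ r)%E.
Proof.
by move=> r0 a0 ab; apply: gt0_ler_poweR => //;
  rewrite in_itv /= leey andbT// (le_trans a0).
Qed.

Lemma lnorm_leP x (e : R) : 0 <= e ->
  (lnorm p x <= e%:E)%E <->
  forall N, \sum_(0 <= n < N) (rnorm (x n)) `^ p <= e `^ p.
Proof.
move=> e0; rewrite lnormE.
set S := (\sum_(n <oo) _)%E.
have S0 : (0 <= S)%E by apply: nneseries_ge0 => n _ _; rewrite lee_fin powR_ge0.
have -> : ((S `^ p^-1) <= e%:E)%E <-> (S <= (e `^ p)%:E)%E.
  have eE : e%:E = ((e `^ p)%:E `^ p^-1)%E.
    by rewrite poweR_EFin -powRrM mulfV ?gt_eqF// powRr1.
  split => [h|h].
    have := @le_poweR p _ _ (ltW p0) (poweR_ge0 _ _) h.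
    by rewrite -poweRrM mulVf ?gt_eqF// poweRe1.
  by rewrite eE le_poweR// invr_ge0 ltW.
split => [h N|h].
  rewrite -lee_fin -sumEFin (le_trans _ h)// /S.
  by apply: nneseries_lim_ge => n _ _; rewrite lee_fin powR_ge0.
apply: lime_le; first by apply: is_cvg_nneseries => n _ _; rewrite lee_fin powR_ge0.
by apply: nearW => N; rewrite sumEFin lee_fin.
Qed.

Lemma lnorm_ge_coord x n : ((rnorm (x n))%:E <= lnorm p x)%E.
Proof.
have := lnorm_ge0 x; case E : (lnorm p x) => [r| |]; rewrite ?leey// lee_fin => r0.
have /(lnorm_leP _ r0) /(_ n.+1) : (lnorm p x <= r%:E)%E by rewrite E.
rewrite big_nat_recr//= => h.
have : (rnorm (x n)) `^ p <= r `^ p.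
  by apply: le_trans h; rewrite lerDr sumr_ge0// => i _; rewrite powR_ge0.
apply: contraTT; rewrite -!ltNge => rx.
by rewrite gt0_ltr_powR ?nnegrE ?rnorm_ge0.
Qed.

Lemma le_lnorm x y : (forall n, rnorm (x n) <= rnorm (y n)) ->
  (lnorm p x <= lnorm p y)%E.
Proof.
move=> xy; have := lnorm_ge0 y; case E : (lnorm p y) => [r| |]; rewrite ?leey//.
rewrite lee_fin => r0; apply/lnorm_leP => // N.
have /(lnorm_leP _ r0) /(_ N) : (lnorm p y <= r%:E)%E by rewrite E.
apply: le_trans; apply: ler_sum => n _.
by apply: ge0_ler_powR (xy n); rewrite ?nnegrE ?rnorm_ge0// ltW.
Qed.

Lemma lnormD x y : (lnorm p (fun n => x n + y n)%R <= lnorm p x + lnorm p y)%E.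
Proof.
have mt (f : nat -> R) : measurable_fun [set: nat] f by [].
have := @eminkowski _ _ R (@counting nat R) (fun n => rnorm (x n))
  (fun n => rnorm (y n)) p%:E (mt _) (mt _).
rewrite lee_fin => /(_ p1); apply: le_trans.
pose z n : K^o := sofR k (rnorm (x n) + rnorm (y n)).
have zE n : rnorm (z n) = rnorm (x n) + rnorm (y n).
  by rewrite /rnorm ger0_norm ?sofRK// -(sofR0 (k := k)) ler_sofR addr_ge0 ?rnorm_ge0.
suff : (lnorm p (fun n => x n + y n)%R <= lnorm p z)%E.
  move=> /le_trans; apply; rewrite le_eqVlt; apply/orP; left; apply/eqP.
  by rewrite /lnorm; congr Lnorm; apply/funext => n; rewrite zE.
by apply: le_lnorm => n; rewrite zE rnormD.
Qed.

Lemma lnorm_cst0 : lnorm p (fun=> 0 : K^o) = 0%E.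
Proof.
apply/eqP; rewrite eq_le lnorm_ge0 andbT; apply/lnorm_leP => // N.
by rewrite big1 ?powR_ge0// => i _; rewrite rnorm0 powR0 ?gt_eqF.
Qed.

Lemma lnormZ_le (a : K) x :
  (lnorm p (fun n => a *: x n)%R <= (rnorm (a : K^o))%:E * lnorm p x)%E.
Proof.
have [->|a0] := eqVneq a 0.
  by rewrite rnorm0 mul0e (_ : (fun _ => _) = fun=> 0) ?lnorm_cst0//; apply/funext => n; rewrite scale0r.
have ra : 0 < rnorm (a : K^o).
  rewrite lt_neqAle rnorm_ge0 andbT eq_sym; apply/eqP => /rnorm0_eq0 ae0.
  by rewrite ae0 eqxx in a0.
have := lnorm_ge0 x; case E : (lnorm p x) => [r| |]//; last first.
  by rewrite gt0_muley ?lte_fin// ?leey.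
rewrite lee_fin => r0; rewrite -EFinM; apply/lnorm_leP; first by rewrite mulr_ge0// ltW.
have /(lnorm_leP _ r0) h : (lnorm p x <= r%:E)%E by rewrite E.
move=> N; rewrite powRM ?(ltW ra)//.
under eq_bigr => n _ do rewrite rnormZ powRM ?rnorm_ge0//.
rewrite -mulr_sumr. by rewrite ler_wpM2l ?powR_ge0.
Qed.

End Lnorm.

Definition ell_pred {R : realType} (k : scalar_kind) (p : R) :
  {pred nat -> (scalars R k)^o} := [pred x | (lnorm p x < +oo)%E].

Record ell {R : realType} (k : scalar_kind) (p : R) (p1 : 1 <= p) := Ell {
  ell_seq :> nat -> (scalars R k)^o;
  ell_seqP : ell_seq \in @ell_pred R k p }.

Section Ell.
Context {R : realType} (k : scalar_kind) (p : R) (p1 : 1 <= p).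
Local Notation K := (scalars R k).
Local Notation lp := (@ell R k p p1).

HB.instance Definition _ := [isSub for @ell_seq R k p p1].
HB.instance Definition _ := [Choice of lp by <:].

Let ell_submod_closed : submod_closed (@ell_pred R k p).
Proof.
split; first by rewrite inE /= (_ : 0 = fun=> 0)// lnorm_cst0.
move=> a x y; rewrite !inE /= => xoo yoo.
rewrite (le_lt_trans (lnormD p1 (fun n => a *: x n) y))// lte_add_pinfty//.
rewrite (le_lt_trans (lnormZ_le p1 _ _))// lte_mul_pinfty// lee_fin.
exact: rnorm_ge0.
Qed.

HB.instance Definition _ :=
  GRing.isSubmodClosed.Build K (nat -> K^o) (@ell_pred R k p) ell_submod_closed.
HB.instance Definition _ := [SubChoice_isSubLmodule of lp by <:].

Implicit Types x y : lp.

Let nm x : R := fine (lnorm p x).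

Let nmE x : (nm x)%:E = lnorm p x.
Proof.
rewrite fineK// ge0_fin_numE ?lnorm_ge0//.
exact: (ell_seqP x).
Qed.

Let nm_ge0 x : 0 <= nm x.
Proof. by rewrite -lee_fin nmE lnorm_ge0. Qed.

Let nmD x y : nm (x + y) <= nm x + nm y.
Proof. by rewrite -lee_fin EFinD !nmE; exact: lnormD. Qed.

Let nmZ_le (a : K) x : nm (a *: x) <= rnorm (a : K^o) * nm x.
Proof. by rewrite -lee_fin EFinM !nmE; exact: lnormZ_le. Qed.

Let nmZ (a : K) x : nm (a *: x) = rnorm (a : K^o) * nm x.
Proof.
apply/eqP; rewrite eq_le nmZ_le/=.
have [->|a0] := eqVneq a 0; first by rewrite rnorm0 mul0r.
have ra : 0 < rnorm (a : K^o).
  rewrite lt_neqAle rnorm_ge0 andbT eq_sym; apply/eqP => /rnorm0_eq0 ae0.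
  by rewrite ae0 eqxx in a0.
rewrite -ler_pdivlMl//.
have := nmZ_le a^-1 (a *: x).
rewrite scalerA mulVf// scale1r; suff -> : rnorm (a^-1 : K^o) = (rnorm (a : K^o))^-1 by [].
apply: (mulIf (lt0r_neq0 ra)); rewrite mulVf ?gt_eqF// -rnormZ.
by rewrite /GRing.scale /= mulVf// /rnorm normr1 -(sofRK (k := k) 1); case: (k).
Qed.

Let norm x : K := sofR k (nm x).

Let ell_normD x y : norm (x + y) <= norm x + norm y.
Proof. by rewrite -sofRD ler_sofR nmD. Qed.
Let ell_normZ (a : K) x : norm (a *: x) = `|a| * norm x.
Proof. by rewrite /norm nmZ sofRM -rnormE. Qed.
Let ell_norm0_eq0 x : norm x = 0 -> x = 0.
Proof.
move=> /(congr1 sRe); rewrite sofRK -(sofR0 (k := k)) sofRK => x0.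
apply/val_inj/funext => n; apply: rnorm0_eq0; apply/eqP.
by rewrite eq_le rnorm_ge0 andbT -lee_fin -x0 nmE lnorm_ge_coord.
Qed.

HB.instance Definition _ :=
  Lmodule_isNormed.Build K lp ell_normD ell_normZ ell_norm0_eq0.

Lemma ell_rnormE x : (rnorm x)%:E = lnorm p x.
Proof. by rewrite /rnorm sofRK nmE. Qed.

Lemma ell_complete (F : set_system lp) : ProperFilter F -> cauchy F -> cvg F.
Proof.
move=> FF /cauchy_ballP FC.
have FC' (e : R) : 0 < e ->
    exists2 A, F A & forall x y, A x -> A y -> rnorm (x - y) <= e.
  move=> e0; have ke0 : 0 < sofR k e by rewrite -(sofR0 (k := k)) ltr_sofR.
  have := FC _ ke0; rewrite !near_simpl => -[[A B] [/= FA FB] AB].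
  exists (A `&` B); first exact: filterI.
  move=> x y [Ax _] [_ By]; have := AB (x, y) (conj Ax By).
  rewrite -ball_normE /ball_ /= => xye.
  by rewrite -(sofRK (k := k) e) ler_sRe// ltW.
have cc n : cvg ((fun x : lp => (x n : K)) @ F).
  apply: scalars_complete; apply/cauchy_ballP => e e0.
  have re0 : 0 < sRe e by rewrite -(sofRK (k := k) 0) sofR0 ltr_sRe.
  have [A FA hA] := FC' _ (divr_gt0 re0 (ltr0Sn _ 1)).
  exists ((fun x : lp => (x n : K)) @` A, (fun x : lp => (x n : K)) @` A) => /=.
    by split; rewrite /nbhs /= /fmap /=; apply: filterS FA => x Ax; exists x.
  move=> [_ _] [/= [x Ax <-] [y Ay <-]].
  rewrite -ball_normE /ball_ /= -[`| _ |]sReK// -[ltRHS]sReK ?ltW// ltr_sofR.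
  apply: (@le_lt_trans _ _ (sRe e / 2)); last first.
    by rewrite ltr_pdivrMr// ltr_pMr// ltr1n.
  apply: le_trans (hA _ _ Ax Ay); rewrite -lee_fin ell_rnormE.
  exact: (lnorm_ge_coord p1 (x - y) n).
pose l : nat -> K^o := fun n => lim ((fun x : lp => (x n : K)) @ F).
have trc (N : nat) (d : R) : 0 < d ->
    \forall y \near F, forall n, (n < N)%N -> rnorm ((y : lp) n - l n) <= d.
  move=> d0; elim: N => [|N IH]; first by near=> y.
  have kd0 : 0 < sofR k d by rewrite -(sofR0 (k := k)) ltr_sofR.
  have /cvgrPdist_lt /(_ _ kd0) := cc N.
  apply: filterS2 IH => y IH; rewrite -/(l N) => yd n.
  rewrite ltnS leq_eqVlt => /predU1P[->|]; last exact: IH.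
  by rewrite -rnormN opprB -(sofRK (k := k) d) ler_sRe// ltW.
pose tr (N : nat) (x : nat -> K^o) : nat -> K^o := fun n => if (n < N)%N then x n else 0.
have trE N (x : nat -> K^o) M :
    \sum_(0 <= n < M) rnorm (tr N x n) `^ p <= \sum_(0 <= n < N) rnorm (x n) `^ p.
  apply: (@le_trans _ _ (\sum_(0 <= n < N + M) rnorm (tr N x n) `^ p)).
    rewrite (@big_cat_nat _ _ _ M 0%N (N + M)%N) ?leq_addl//= lerDl.
    by rewrite sumr_ge0// => n _; rewrite powR_ge0.
  rewrite (@big_cat_nat _ _ _ N 0%N (N + M)%N) ?leq_addr//=.
  rewrite [X in _ + X]big_nat_cond [X in _ + X]big1 ?addr0; last first.
    move=> n /andP[/andP[Nn _] _]; rewrite /tr ltnNge Nn/= rnorm0 powR0//.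
    by rewrite gt_eqF// (lt_le_trans _ p1).
  by rewrite big_nat [leRHS]big_nat ler_sum// => n /andP[_ nN]; rewrite /tr nN.
have p0 : 0 < p by rewrite (lt_le_trans _ p1).
have trl (N : nat) (e : R) : 0 < e ->
    \forall y \near F, (lnorm p (tr N (fun n => (y : lp) n - l n)%R) <= e%:E)%E.
  move=> e0; pose d := (e `^ p / N.+1%:R) `^ p^-1.
  have d0 : 0 < d by rewrite powR_gt0// divr_gt0// powR_gt0.
  have dp : d `^ p = e `^ p / N.+1%:R.
    by rewrite -powRrM mulVf ?gt_eqF// powRr1// divr_ge0// powR_ge0.
  apply: filterS (trc N d d0) => y hy; apply/lnorm_leP => //; first exact: ltW.
  move=> M; apply: le_trans (trE _ _ _) _.
  apply: (@le_trans _ _ (\sum_(0 <= n < N) d `^ p)).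
    rewrite big_nat [leRHS]big_nat ler_sum// => n /andP[_ nN].
    by apply: ge0_ler_powR (hy _ nN); rewrite ?nnegrE ?rnorm_ge0// ltW.
  rewrite sumr_const_nat subn0 dp -[leLHS]mulr_natr -mulrA ler_piMr ?powR_ge0//.
  by rewrite mulrC ler_pdivrMr// mul1r ler_nat.
have hl (e : R) : 0 < e -> exists2 A, F A &
    forall x, A x -> (lnorm p (fun n => x n - l n)%R <= e%:E)%E.
  move=> e0; have e20 : 0 < e / 2 by rewrite divr_gt0.
  have [A FA hA] := FC' _ e20; exists A => // x Ax.
  apply/lnorm_leP => //; first exact: ltW.
  move=> N.
  have [y [Ay hy]] := @filter_ex _ F _ _ (filterI FA (trl N _ e20)).
  suff /(lnorm_leP p1 _ (ltW e0)) /(_ N) :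
      (lnorm p (tr N (fun n => x n - l n)%R) <= e%:E)%E.
    apply: le_trans; rewrite big_nat [leRHS]big_nat ler_sum// => n /andP[_ nN].
    by rewrite /tr nN.
  have -> : tr N (fun n => x n - l n) =
      fun n => tr N (fun n => x n - y n) n + tr N (fun n => y n - l n) n.
    by apply/funext => n; rewrite /tr; case: ifP => _; rewrite ?addr0// addrA subrK.
  rewrite (le_trans (lnormD _ _ _))// (splitr e) EFinD leeD//.
  apply: (@le_trans _ _ (rnorm (x - y))%:E); last by rewrite lee_fin hA.
  rewrite ell_rnormE; apply: le_lnorm => // n.
  by rewrite /tr; case: ifP => // _; rewrite rnorm0 rnorm_ge0.
have loo : l \in @ell_pred R k p.
  have [A FA hA] := hl _ ltr01; have [x Ax] := filter_ex FA.
  rewrite inE /=; have -> : l = fun n => x n + (-1) *: (x n - l n).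
    by apply/funext => n; rewrite scaleN1r opprB addrC subrK.
  rewrite (le_lt_trans (lnormD _ _ _))// lte_add_pinfty//.
    exact: (ell_seqP x).
  rewrite (le_lt_trans (lnormZ_le _ _ _))// lte_mul_pinfty ?lee_fin ?rnorm_ge0//.
  by rewrite (le_lt_trans (hA _ Ax))// ltry.
apply/cvg_ex; exists (Ell p1 loo); apply/cvgrPdist_le => e e0.
have re0 : 0 < sRe e by rewrite -(sofRK (k := k) 0) sofR0 ltr_sRe.
have [A FA hA] := hl _ re0; apply: filterS FA => x Ax.
rewrite distrC -[`| _ |]sReK// -[leRHS](sReK (ltW e0)) ler_sofR.
by rewrite -lee_fin ell_rnormE; exact: hA.
Unshelve. all: by end_near. Qed.

HB.instance Definition _ := Uniform_isComplete.Build lp ell_complete.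

End Ell.

Record closedSubspace {K : numFieldType} (V : completeNormedModType K) :=
  ClosedSubspace {
    cs_pred : {pred V};
    cs_submod : submod_closed cs_pred;
    cs_closed : closed [set` cs_pred] }.

Record cs_type {K : numFieldType} {V : completeNormedModType K}
    (S : closedSubspace V) := CsElt {
  cs_val :> V;
  cs_valP : cs_val \in cs_pred S }.
Coercion cs_type : closedSubspace >-> Sortclass.

Section ClosedSubspace.
Context {K : numFieldType} {V : completeNormedModType K} (S : closedSubspace V).

HB.instance Definition _ :=
  GRing.isSubmodClosed.Build K V (cs_pred S) (cs_submod S).
HB.instance Definition _ := [isSub for @cs_val K V S].
HB.instance Definition _ := [Choice of cs_type S by <:].
HB.instance Definition _ := [SubChoice_isSubLmodule of cs_type S by <:].

Implicit Types x y : cs_type S.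

Let norm x : K := `|val x|.

Let cs_normD x y : norm (x + y) <= norm x + norm y.
Proof. exact: ler_normD. Qed.
Let cs_normZ (a : K) x : norm (a *: x) = `|a| * norm x.
Proof. exact: normrZ. Qed.
Let cs_norm0_eq0 x : norm x = 0 -> x = 0.
Proof. by move=> /normr0_eq0 x0; exact: val_inj. Qed.

HB.instance Definition _ :=
  Lmodule_isNormed.Build K (cs_type S) cs_normD cs_normZ cs_norm0_eq0.

Lemma cs_normE x : `|x| = `|val x|.
Proof. by []. Qed.

Lemma cs_complete (F : set_system (cs_type S)) :
  ProperFilter F -> cauchy F -> cvg F.
Proof.
move=> FF /cauchy_ballP FC.
have : cvg (val @ F : set_system V).
  apply: cauchy_cvg; apply/cauchy_ballP => e e0.
  have := FC _ e0; rewrite !near_simpl => -[[A B] [/= FA FB] AB].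
  exists (val @` A, val @` B) => /=.
    split; rewrite /nbhs /= /fmap /=.
      by apply: filterS FA => x Ax; exists x.
    by apply: filterS FB => x Bx; exists x.
  move=> [_ _] [/= [x Ax <-] [y By <-]].
  by have := AB (x, y) (conj Ax By); rewrite -!ball_normE.
move=> /cvg_ex[l Fl].
have Sl : l \in cs_pred S.
  have := @closed_cvg _ V F FF val _ (cs_closed (c := S)).
  by apply; last exact: Fl; apply: nearW => x; exact: cs_valP.
apply/cvg_ex; exists (CsElt Sl); apply/cvgrPdist_lt => e e0.
by move/cvgrPdist_lt : Fl => /(_ _ e0); apply: filterS.
Qed.

HB.instance Definition _ := Uniform_isComplete.Build (cs_type S) cs_complete.

End ClosedSubspace.

Section Operators.
Context {R : realType} {k : scalar_kind}.
Local Notation K := (scalars R k).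
Implicit Types X Y Z : normedModType K.

(* For linear maps between normed modules, continuous means bounded, see
   linear_bounded_continuous. *)
Definition bounded_op X Y : set {linear X -> Y} := [set T | continuous T].
Arguments bounded_op : clear implicits.

Definition opnorm X Y (T : X -> Y) : R :=
  sup [set rnorm (T x) | x in [set x | rnorm x <= 1]].

Definition finite_rank X Y : set {linear X -> Y} :=
  [set T | bounded_op X Y T /\
    exists n (b : 'I_n -> Y), forall x,
      exists c : 'I_n -> K, T x = \sum_(i < n) c i *: b i].
Arguments finite_rank : clear implicits.

(* The closure of finite_rank X Y in the operator norm. *)
Definition approximable X Y : set {linear X -> Y} :=
  [set T | bounded_op X Y T /\
    forall e : R, 0 < e -> exists2 S, finite_rank X Y S & opnorm (T \- S) < e].
Arguments approximable : clear implicits.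

Definition compact_op X Y : set {linear X -> Y} :=
  [set T | bounded_op X Y T /\ precompact (T @` [set x | rnorm x <= 1])].
Arguments compact_op : clear implicits.

Definition quasi_nuclear (p : R) X Y : set {linear X -> Y} :=
  [set U | bounded_op X Y U /\
    exists f : nat -> {linear X -> K^o},
    [/\ forall j, bounded_op X K^o (f j),
        (\sum_(j <oo) ((opnorm (f j)) `^ p)%:E < +oo)%E &
        forall x, ((rnorm (U x))%:E <=
          (\sum_(j <oo) ((rnorm (f j x)) `^ p)%:E) `^ p^-1)%E]].
Arguments quasi_nuclear : clear implicits.

(* A class I(X, Y) of operators between Banach spaces, such as the components
   of an operator ideal. *)
Definition op_class := forall X Y : completeNormedModType K, set {linear X -> Y}.

Definition uniform_AP (I : op_class) (X : completeNormedModType K) : Prop :=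
  forall Z : completeNormedModType K, I Z X `<=` approximable Z X.

End Operators.
Arguments bounded_op {R k} X Y.
Arguments finite_rank {R k} X Y.
Arguments approximable {R k} X Y.
Arguments compact_op {R k} X Y.
Arguments quasi_nuclear {R k} p X Y.

Lemma lt2_le1 {R : realType} (p : R) : 2 < p -> 1 <= p.
Proof. by move=> p2; rewrite ltW// (lt_trans _ p2)// ltr1n. Qed.

(* Main.v *)
(* Davie's construction, with quadratic forms over F_2 in place of random signs.
   The coordinates are arranged in levels, level n having 2 * 4 ^ n of them, and
   the n-th of a sequence of blocks of 4 ^ n basis vectors lives on the levels n
   and n + 1.  The signs on level n + 1 make the coefficients of block n and of
   block n + 1 orthonormal characters of an elementary abelian 2-group whose
   frequencies lie on quadrics, so that all averages over a block are O(2 ^ - n)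
   off the diagonal.  For an operator T the normalized traces beta_n(T) over the
   blocks then satisfy
     beta_(n+1)(T) - beta_n(T) = average over g in level n + 1 of (T phi_g)(g)
   where phi_g is O(2 ^ - n) in sup norm on three levels.  Putting weights a ^ n
   on level n of l^r and b ^ n on level n of l^q, these differences are summable,
   with a bound linear in the norm of T, as soon as 4 ^ (1/r) a < 2 b.  So beta_n
   is uniformly bounded, tends to 0 on operators of finite rank, and is constantly
   1 on the formal inclusion U, which is therefore not approximable.

   With s = min(p, q) and 4 b ^ s < 1 one has
     |U x| <= C (sum_m b_m ^ s |x_m / a_m| ^ p) ^ (1/p),
   where a_m, b_m are the weights at the coordinate m.  For a = 1 and r large this
   shows that U is quasi p-nuclear on a subspace of l^r, and for r = p and
   b ^ (s/p) < a that U is compact on a subspace of l^p.  As s > 2, a suitable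
   b > 1/2 exists. *)
From HB Require Import structures.
Require Import Defs.
From mathcomp Require Import all_boot all_order all_algebra.
From mathcomp Require Import all_classical all_reals all_analysis.
From mathcomp Require Import zify lra ring.

Set Implicit Arguments.
Unset Strict Implicit.
Unset Printing Implicit Defensive.

Import Order.TTheory GRing.Theory Num.Theory.
Import numFieldNormedType.Exports.

Local Open Scope ring_scope.

(** * Flat sign systems *)

(** [cube n] stands for the space F_2^n. A [fibre n] indexes the vectors of block n, a [base n] the
    coordinates of level n; the tag in [base] doubles their number, which leaves room for a second
    orthogonal family of signs. *)
Definition cube n := {ffun 'I_n -> bool}.
Definition fibre n := (cube n * cube n)%type.
Definition base n := (fibre n * bool)%type.

(** Reading [false] beyond n lets shifted indices run off the end without side conditions. *)
Definition bit n (x : cube n) (m : nat) : bool :=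
  if insub m is Some i then x i else false.

(* The last term leaves out the final coordinate of y: it is the third shift on
   the cube one dimension lower, seen from the present one. *)
Definition shifts n (c : nat -> bool) (y : cube n) (l : nat) : bool :=
  (c 0%N && bit y l) (+) (c 1%N && bit y l.+1) (+) (c 2%N && bit y l.+2) (+)
  (c 3%N && bit y l.+3) (+) (c 4%N && ((l.+4 < n)%N && bit y l.+3)).

Lemma bit_ord n (x : cube n) (i : 'I_n) : bit x i = x i.
Proof. by rewrite /bit valK. Qed.

Lemma bit_ge n (x : cube n) m : (n <= m)%N -> bit x m = false.
Proof. by move=> nm; rewrite /bit insubF// ltnNge nm. Qed.

Lemma bit_inj n (x y : cube n) : bit x =1 bit y -> x = y.
Proof. by move=> xy; apply/ffunP => i; rewrite -!bit_ord xy. Qed.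

Definition extend n (x : cube n) (s : bool) : cube n.+1 :=
  [ffun l : 'I_n.+1 => if (l < n)%N then bit x l else s].

Lemma bit_extend_lt n (x : cube n) s m : (m < n)%N ->
  bit (extend x s) m = bit x m.
Proof.
move=> mn; have mn1 : (m < n.+1)%N by rewrite ltnS ltnW.
by rewrite -[LHS]/(bit (extend x s) (Ordinal mn1)) bit_ord ffunE /= mn.
Qed.

Lemma bit_extend_eq n (x : cube n) s : bit (extend x s) n = s.
Proof. by rewrite -[LHS]/(bit (extend x s) (@ord_max n)) bit_ord ffunE /= ltnn. Qed.

Lemma card_cube n : #|{: cube n}| = (2 ^ n)%N.
Proof. by rewrite card_ffun card_bool card_ord. Qed.

Lemma card_fibre n : #|{: fibre n}| = (4 ^ n)%N.
Proof. by rewrite card_prod card_cube -expnMn. Qed.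

Lemma card_base n : #|{: base n}| = (2 * 4 ^ n)%N.
Proof. by rewrite card_prod card_fibre card_bool mulnC. Qed.

Section Signs.
Context {K : numDomainType}.

Definition sg (b : bool) : K := (-1) ^+ b.

Lemma sgD a b : sg (a (+) b) = sg a * sg b.
Proof. exact: signr_addb. Qed.

Lemma sg_norm b : `|sg b| = 1.
Proof. by rewrite normrX normrN1 expr1n. Qed.

Lemma sg_sq b : sg b * sg b = 1.
Proof. by rewrite -sgD addbb. Qed.

(** The character of F_2^n of frequency [u]; only the values of [u] below n matter. *)
Definition walsh n (u : nat -> bool) (x : cube n) : K :=
  \prod_(l < n) sg (u l && bit x l).

(** The sign of a bilinear form pairing the first component of [j] with shifts of the second, hence
    of a quadratic form in [j]. *)
Definition quad n (c : nat -> bool) (j : fibre n) : K :=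
  walsh (shifts c j.2) j.1.

Definition phase n (u v c : nat -> bool) (j : fibre n) : K :=
  walsh u j.1 * walsh v j.2 * quad c j.

Lemma walshD n u v (x : cube n) :
  walsh (fun l => u l (+) v l) x = walsh u x * walsh v x.
Proof. by rewrite -big_split; apply: eq_bigr => l _ /=; rewrite -sgD andb_addl. Qed.

Lemma eq_walsh n u v (x : cube n) : (forall l, (l < n)%N -> u l = v l) ->
  walsh u x = walsh v x.
Proof. by move=> uv; apply: eq_bigr => l _; rewrite uv. Qed.

Lemma walshC n (x y : cube n) : walsh (bit x) y = walsh (bit y) x.
Proof. by apply: eq_bigr => l _; rewrite andbC. Qed.

Lemma walsh_norm n u (x : cube n) : `|walsh u x| = 1.
Proof. by rewrite normr_prod big1// => l _; rewrite sg_norm. Qed.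

Lemma walsh_sq n u (x : cube n) : walsh u x * walsh u x = 1.
Proof. by rewrite -big_split big1// => l _; rewrite /= sg_sq. Qed.

(** The sum over the cube factors over the coordinates, each factor being 2 or 0. *)
Lemma sum_walsh n u :
  \sum_(x : cube n) walsh u x = if [forall l : 'I_n, ~~ u l] then 2 ^+ n else 0.
Proof.
rewrite /walsh.
under eq_bigr do under eq_bigr do rewrite bit_ord.
rewrite -(bigA_distr_bigA (fun (l : 'I_n) b => sg (u l && b))).
under eq_bigr do rewrite big_bool/= andbT andbF.
case: ifPn => [/forallP u0|].
  under eq_bigr do rewrite (negbTE (u0 _)).
  by rewrite prodr_const card_ord.
rewrite negb_forall => /existsP[l]; rewrite negbK => ul.
by rewrite (bigD1 l)//= ul /sg expr1 expr0 addNr mul0r.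
Qed.

Lemma sum_walsh_pair n (x y : cube n) :
  \sum_(a : cube n) walsh (bit a) x * walsh (bit a) y =
  if x == y then 2 ^+ n else 0.
Proof.
under eq_bigr do rewrite walshC (walshC _ y) -walshD.
rewrite sum_walsh; congr (if _ then _ else _).
apply/forallP/eqP => [h|-> l]; last by rewrite addbb.
by apply/ffunP => l; have := h l; rewrite !bit_ord; case: (x l) (y l) => [] [].
Qed.

(** As [shifts] is additive in [c], phases form a group, and products of signs are again single
    phases. *)
Lemma phaseM n u v c u' v' c' (j : fibre n) :
  phase u v c j * phase u' v' c' j =
  phase (fun l => u l (+) u' l) (fun l => v l (+) v' l) (fun l => c l (+) c' l) j.
Proof.
have qD : quad (fun l => c l (+) c' l) j = quad c j * quad c' j.
  rewrite /quad -walshD; apply: eq_walsh => l _; rewrite /shifts !andb_addl.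
  by rewrite [RHS]addbACA; do 3!(congr (_ (+) _); rewrite [RHS]addbACA).
rewrite /phase qD (walshD u u') (walshD v v') mulrACA; congr (_ * _).
exact: mulrACA.
Qed.

Lemma phase_norm n u v c (j : fibre n) : `|phase u v c j| = 1.
Proof. by rewrite /phase !normrM !walsh_norm !mulr1. Qed.

(** For fixed y the phase is a character in the first component, so summing over the latter removes
    every y that does not solve u = [shifts c y]. *)
Lemma sum_phase n u v c :
  \sum_(j : fibre n) phase u v c j =
  2 ^+ n * \sum_(y : cube n | [forall l : 'I_n, u l == shifts c y l]) walsh v y.
Proof.
rewrite -(pair_big_dep xpredT (fun _ => xpredT)
  (fun x y => phase u v c (x, y)))/= exchange_big/= mulr_sumr.
rewrite [RHS]big_mkcond/=; apply: eq_bigr => y _.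
transitivity (walsh v y * \sum_(x : cube n) walsh (fun l => u l (+) shifts c y l) x).
  rewrite mulr_sumr; apply: eq_bigr => x _.
  by rewrite walshD /phase /quad/= mulrA (mulrC (walsh v y)).
rewrite sum_walsh; set P := [forall l, _]; set Q := [forall l, _].
suff -> : P = Q by case: Q; rewrite ?mulr0// mulrC.
by apply: eq_forallb => l; case: (u l) (shifts c y l) => [] [].
Qed.

(* The lowest shift present in c makes the system triangular, so its solutions
   are determined by their first three coordinates and the last one. *)
Lemma card_shifts_eq n (u c : nat -> bool) :
  c 0%N || c 1%N || c 2%N || (c 3%N (+) c 4%N) ->
  (#|[set y : cube n | [forall l : 'I_n, u l == shifts c y l]]| <= 16)%N.
Proof.
move=> hc.
pose f (y : cube n) := ((bit y 0%N, bit y 1%N), (bit y 2%N, bit y n.-1)).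
rewrite -(@card_in_imset _ _ f); last first.
  move=> y z; rewrite !inE => /forallP hy /forallP hz [e0 e1 e2 en].
  have E l : (l < n)%N -> shifts c y l = shifts c z l.
    by move=> ln; rewrite -(eqP (hy (Ordinal ln))) -(eqP (hz (Ordinal ln))).
  (* Downward induction: k bounds the distance of m from n, so all higher bits are already known to
     agree. *)
  suff H k m : (n <= m + k)%N -> bit y m = bit z m.
    by apply: bit_inj => m; apply: (H n); rewrite leq_addl.
  elim: k m => [|k IH] m nmk; first by rewrite addn0 in nmk; rewrite !bit_ge.
  have [mn|nm] := ltnP m n; last by rewrite !bit_ge.
  have {IH nmk} I m' : (m < m')%N -> bit y m' = bit z m'.
    by move=> mm'; apply/IH/(leq_trans nmk); rewrite addnS -addSn leq_add2r.
  have I1 : bit y m.+1 = bit z m.+1 by exact: I.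
  have I2 : bit y m.+2 = bit z m.+2 by apply: I; clear; lia.
  have I3 : bit y m.+3 = bit z m.+3 by apply: I; clear; lia.
  have [->//|mn1] := eqVneq m n.-1.
  have nm1 : (m.+1 < n)%N by clear -mn mn1; lia.
  have [c0|/negbTE c0] := boolP (c 0%N).
    have := E m mn; rewrite /shifts c0/= I1 I2 I3.
    by do 4!move/addIb.
  rewrite c0/= in hc.
  have [c1|/negbTE c1] := boolP (c 1%N).
    case: m => [//|m] in mn nm1 mn1 I I1 I2 I3 *.
    have := E m (ltnW mn); rewrite /shifts c0 c1/= I1 I2.
    by do 3!move/addIb.
  rewrite c1/= in hc.
  have [c2|/negbTE c2] := boolP (c 2%N).
    case: m => [//|[//|m]] in mn nm1 mn1 I I1 I2 I3 *.
    have := E m (ltnW (ltnW mn)); rewrite /shifts c0 c1 c2/= I1.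
    by do 2!move/addIb.
  rewrite c2/= in hc.
  (* As m is not the last coordinate, the shifts 3 and 4 read the same bit in this equation; exactly
     one of [c 3], [c 4] is set, so the bit survives. *)
  case: m => [//|[//|[//|m]]] in mn nm1 mn1 I I1 I2 I3 *.
  have := E m (ltnW (ltnW (ltnW mn))); rewrite /shifts c0 c1 c2/= nm1/=.
  by move: hc; case: (c 3%N) (c 4%N) => [] [] //= _; rewrite ?addbF.
by apply: leq_trans (max_card _) _; rewrite !card_prod card_bool.
Qed.

(** By [sum_phase] the sum is 2^n times a sum of at most 16 signs. *)
Lemma phase_flat n u v c : c 0%N || c 1%N || c 2%N || (c 3%N (+) c 4%N) ->
  `|\sum_(j : fibre n) phase u v c j| <= 16 * 2 ^+ n.
Proof.
move=> hc; rewrite sum_phase normrM mulrC normrX normr_nat ler_wpM2r ?exprn_ge0//.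
apply: le_trans (ler_norm_sum _ _ _) _.
under eq_bigr do rewrite walsh_norm.
rewrite sumr_const ler_nat; have := card_shifts_eq n u hc.
by rewrite cardsE.
Qed.

(** Without a quadratic part the phase is a nontrivial character, which sums to zero. *)
Lemma phase_sum0 n u v c : (forall l, (l < 5)%N -> c l = false) ->
  (exists2 l, (l < n)%N & u l || v l) ->
  \sum_(j : fibre n) phase u v c j = 0.
Proof.
move=> c0 [l ln uvl]; rewrite sum_phase.
have s0 (y : cube n) m : shifts c y m = false by rewrite /shifts !c0.
under eq_bigl do under eq_forallb do rewrite s0.
have [ul|nul] := boolP (u l).
  by rewrite big1 ?mulr0// => y /forallP/(_ (Ordinal ln))/=; rewrite ul.
rewrite (negbTE nul)/= in uvl; apply/eqP; rewrite mulf_eq0; apply/orP; right.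
case: (boolP [forall l : 'I_n, u l == false]) => u0; last by rewrite big_pred0.
by rewrite sum_walsh ifF//; apply/negbTE/forallPn; exists (Ordinal ln); rewrite negbK.
Qed.

(** Coefficients of quadratic parts. [lo] uses only shift 4 and [hi] only the shifts 1 to 3; shift 0
    is reserved for the common factor of [downsign]. *)
Definition lo (w : bool) (i : nat) := (i == 4%N) && w.
Definition hi (a b w : bool) := nth false [:: false; a; b; w].

(* On level n live two orthonormal families of signs, mutually orthogonal:
   downsign, indexed by fibre n, and upsign, indexed by fibre n.-1.  By upsignE,
   the latter is, up to the tag g.2, a subfamily of the characters underlying the
   former, but it is spread out by quadratic forms.  The first factor of downsign
   does not depend on g; it is there to make the products of a downsign and an
   upsign flat as well. *)
Definition downsign n (j : fibre n) (g : base n) : K :=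
  phase xpred0 xpred0 (pred1 0%N) j * phase (bit g.1.1) (bit g.1.2) (lo g.2) j.

Definition upsign n (j : fibre n) (g : base n.+1) : K :=
  sg g.2 * phase (bit g.1.1) (bit g.1.2) (hi (bit g.1.1 n) (bit g.1.2 n) g.2) j.

Lemma downsign_norm n (j : fibre n) g : `|downsign j g| = 1.
Proof. by rewrite normrM !phase_norm mulr1. Qed.

Lemma upsign_norm n (j : fibre n) g : `|upsign j g| = 1.
Proof. by rewrite normrM sg_norm phase_norm mulr1. Qed.

Lemma phase_sq n u v c (j : fibre n) : phase u v c j * phase u v c j = 1.
Proof. by rewrite /phase mulrACA walsh_sq mulr1 mulrACA !walsh_sq mulr1. Qed.

Lemma downsign_sq n (j : fibre n) g : downsign j g * downsign j g = 1.
Proof. by rewrite mulrACA !phase_sq mulr1. Qed.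

Lemma upsign_sq n (j : fibre n) g : upsign j g * upsign j g = 1.
Proof. by rewrite mulrACA sg_sq phase_sq mulr1. Qed.

Lemma downsign_pair n (j : fibre n) g h :
  downsign j g * downsign j h =
  phase (bit g.1.1) (bit g.1.2) (lo g.2) j * phase (bit h.1.1) (bit h.1.2) (lo h.2) j.
Proof. by rewrite mulrACA phase_sq mul1r. Qed.

Lemma neq_cube n (x y : cube n) : x != y ->
  exists2 l, (l < n)%N & bit x l (+) bit y l.
Proof.
move=> /eqP xy; have [/existsP[l hl]|/existsPn h] :=
    boolP [exists l : 'I_n, bit x l (+) bit y l]; first by exists l.
exfalso; apply: xy; apply/ffunP => l; have := h l; rewrite !bit_ord.
by case: (x l) (y l) => [] [].
Qed.

Lemma neq_fibre n (x y : fibre n) : x != y ->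
  exists2 l, (l < n)%N & (bit x.1 l (+) bit y.1 l) || (bit x.2 l (+) bit y.2 l).
Proof.
move: x y => [x1 x2] [y1 y2]; rewrite xpair_eqE negb_and.
by case/orP => /neq_cube[l ln h]; exists l => //=; rewrite h ?orbT.
Qed.

(** Different tags leave shift 4 in the product, which is then flat; equal tags leave a nontrivial
    character. *)
Lemma downsign_flat n (g h : base n) : g != h ->
  `|\sum_(j : fibre n) downsign j g * downsign j h| <= 16 * 2 ^+ n.
Proof.
move=> gh; under eq_bigr do rewrite downsign_pair phaseM.
have [w|w] := boolP (g.2 (+) h.2).
  by apply: phase_flat; rewrite /lo/= w.
rewrite phase_sum0 ?normr0 ?mulr_ge0 ?exprn_ge0//.
  by move=> l _; rewrite /lo -andb_addr (negbTE w) andbF.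
apply: neq_fibre.
apply: contra_neq gh; case: g h w => [g1 g2] [h1 h2]/= w ->.
by congr pair; move: w; case: (g2) (h2) => [] [].
Qed.

(** If the top frequency bits or the tags differ, one of the shifts 1 to 3 remains in the product;
    otherwise the frequencies differ below n and a nontrivial character remains. *)
Lemma upsign_flat n (g h : base n.+1) : g != h ->
  `|\sum_(j : fibre n) upsign j g * upsign j h| <= 16 * 2 ^+ n.
Proof.
move=> gh; under eq_bigr do rewrite mulrACA phaseM.
rewrite -mulr_sumr !normrM !sg_norm !mul1r.
have [w|] := boolP [|| bit g.1.1 n (+) bit h.1.1 n,
    bit g.1.2 n (+) bit h.1.2 n | g.2 (+) h.2].
  by apply: phase_flat; rewrite /hi/= addbF -orbA.
rewrite !negb_or => /and3P[w1 w2 w3].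
rewrite phase_sum0 ?normr0 ?mulr_ge0 ?exprn_ge0//.
  by case=> [|[|[|[|[|]]]]]//= _; exact: negbTE.
have [] := @neq_fibre _ g.1 h.1.
  apply: contra_neq gh; case: g h w3 {w1 w2} => [g1 g2] [h1 h2]/= w ->.
  by congr pair; move: w; case: (g2) (h2) => [] [].
move=> l; rewrite ltnS leq_eqVlt => /predU1P[->|ln h']; last by exists l.
by rewrite (negbTE w1) (negbTE w2).
Qed.

(** Shift 0 occurs in the product exactly once, through the common factor of [downsign]. *)
Lemma downsign_upsign_flat n (g : base n) (h : base n.+1) :
  `|\sum_(j : fibre n) downsign j g * upsign j h| <= 16 * 2 ^+ n.
Proof.
under eq_bigr do rewrite mulrCA /downsign !phaseM.
by rewrite -mulr_sumr normrM sg_norm mul1r; exact: phase_flat.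
Qed.

(** Here the sum runs over frequencies: the quadratic signs do not depend on them and come out,
    leaving orthogonality of characters in each component. *)
Lemma sum_phase_pair n c (i j : fibre n) :
  \sum_(g : fibre n) phase (bit g.1) (bit g.2) c i * phase (bit g.1) (bit g.2) c j =
  if i == j then 4 ^+ n else 0.
Proof.
rewrite -(pair_big_dep xpredT (fun _ => xpredT) (fun x y =>
  phase (bit x) (bit y) c i * phase (bit x) (bit y) c j))/=.
transitivity (quad c i * quad c j *
  ((\sum_(a : cube n) walsh (bit a) i.1 * walsh (bit a) j.1) *
   (\sum_(a : cube n) walsh (bit a) i.2 * walsh (bit a) j.2))).
  rewrite big_distrlr/= mulr_sumr; apply: eq_bigr => a _.
  rewrite mulr_sumr; apply: eq_bigr => b _.
  by rewrite /phase mulrACA mulrC; congr (_ * _); exact: mulrACA.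
rewrite !sum_walsh_pair; case: i j => [x y] [x' y']; rewrite xpair_eqE/=.
have [->|] := eqVneq x x'; have [->|] := eqVneq y y'; rewrite ?(mul0r, mulr0)//=.
by rewrite /quad walsh_sq mul1r -exprMn -natrM.
Qed.

Definition bent n (d : nat) (j : fibre n) : bool :=
  \big[addb/false]_(l < n) (bit j.1 l && bit j.2 (l + d)).

(** Appending two quadratic forms of [j] as top coordinates embeds [fibre n] into [fibre n.+1] as an
    intersection of two quadrics; a linear character restricted to it becomes a quadratic phase. *)
Definition lift_fibre n (j : fibre n) : fibre n.+1 :=
  (extend j.1 (bent 1%N j), extend j.2 (bent 2%N j)).

Lemma lift_fibre_inj n : injective (@lift_fibre n).
Proof.
have extend_inj (x x' : cube n) s s' : extend x s = extend x' s' -> x = x'.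
  move=> e; apply: bit_inj => l; have [ln|nl] := ltnP l n; last by rewrite !bit_ge.
  by have := congr1 (fun z => bit z l) e; rewrite /= !bit_extend_lt.
move=> [x y] [x' y'] e; congr pair.
- by have /extend_inj := congr1 fst e.
- by have /extend_inj := congr1 snd e.
Qed.

Lemma walsh_extend n u (x : cube n) s :
  walsh u (extend x s) = walsh u x * sg (u n && s).
Proof.
rewrite /walsh big_ord_recr/= bit_extend_eq; congr (_ * _).
by apply: eq_bigr => l _; rewrite bit_extend_lt.
Qed.

Lemma sg_bent n d a (j : fibre n) :
  sg (a && bent d j) = walsh (fun l => a && bit j.2 (l + d)) j.1.
Proof.
rewrite /bent (big_morph (fun b => sg (a && b)) (id1 := 1) (op1 := *%R)); first last.
- by rewrite andbF.
- by move=> x y; rewrite andb_addr sgD.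
- by apply: eq_bigr => l _; rewrite -andbA [bit j.1 l && _]andbC.
Qed.

(** The top frequency bits pick up the appended coordinates and yield the shifts 1 and 2. Shift 4 in
    dimension n+1 ignores the appended coordinate and so is shift 3 in dimension n. *)
Lemma upsignE n (j : fibre n) (g : base n.+1) :
  upsign j g = sg g.2 * phase (bit g.1.1) (bit g.1.2) (lo g.2) (lift_fibre j).
Proof.
rewrite /upsign; congr (_ * _); set a := bit g.1.1; set b := bit g.1.2.
rewrite /phase /quad /lift_fibre/= !walsh_extend.
have -> : shifts (lo g.2) (extend j.2 (bent 2%N j)) n && bent 1%N j = false.
  by rewrite /shifts/= (_ : (n.+4 < n.+1)%N = false) ?andbF//; clear; lia.
rewrite !sg_bent [sg false]expr0 mulr1.
rewrite [X in _ = X * _]mulrACA -[RHS]mulrA; congr (_ * _).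
rewrite -!walshD; apply: eq_walsh => l ln; rewrite /shifts /lo/= addn1 addn2.
rewrite ltnS; have [l3|l3] := ltnP l.+3 n; first by rewrite bit_extend_lt ?addbF ?addbA.
by rewrite (bit_ge _ l3) !andbF !addbF.
Qed.

Lemma sum_base n (F : base n -> K) :
  \sum_g F g = \sum_(w : bool) \sum_(ab : fibre n) F (ab, w).
Proof.
rewrite exchange_big/= pair_big/=; apply: eq_bigr => -[ab w] _ //.
Qed.

Lemma downsign_orth n (i j : fibre n) :
  \sum_(g : base n) downsign i g * downsign j g = if i == j then #|{: base n}|%:R else 0.
Proof.
have [<-|ij] := eqVneq i j.
  by under eq_bigr do rewrite downsign_sq; rewrite sumr_const.
rewrite sum_base big1// => w _.
under eq_bigr do rewrite /downsign/= mulrACA.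
by rewrite -mulr_sumr sum_phase_pair (negbTE ij) mulr0.
Qed.

Lemma upsign_orth n (i j : fibre n) :
  \sum_(g : base n.+1) upsign i g * upsign j g =
  if i == j then #|{: base n.+1}|%:R else 0.
Proof.
have [<-|ij] := eqVneq i j.
  by under eq_bigr do rewrite upsign_sq; rewrite sumr_const.
rewrite sum_base big1// => w _.
under eq_bigr do rewrite !upsignE/= mulrACA.
by rewrite -mulr_sumr sum_phase_pair (inj_eq (@lift_fibre_inj n)) (negbTE ij) mulr0.
Qed.

(** The two tags contribute equal sums up to the factor [sg g.2], so they cancel. *)
Lemma upsign_downsign_orth n (i : fibre n) (j : fibre n.+1) :
  \sum_(g : base n.+1) upsign i g * downsign j g = 0.
Proof.
rewrite sum_base big_bool/=.
under eq_bigr do rewrite upsignE /downsign/= mulrACA.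
under [X in _ + X]eq_bigr do rewrite upsignE /downsign/= mulrACA.
rewrite -!mulr_sumr !sum_phase_pair -mulrDl -mulrDl.
by rewrite /sg expr0 expr1 addNr !mul0r.
Qed.

End Signs.

Local Open Scope classical_set_scope.
Local Open Scope ring_scope.

(** * Bounded operators and the operator norm *)

Section Operators.
Context {R : realType} {k : scalar_kind}.
Local Notation K := (scalars R k).
Implicit Types X Y V : normedModType K.

Lemma sofR_ge0 (a : R) : (0 <= sofR k a) = (0 <= a).
Proof. by rewrite -[X in X <= _](sofR0 (k := k)) ler_sofR. Qed.

Lemma sofR_gt0 (a : R) : (0 < sofR k a) = (0 < a).
Proof. by rewrite -[X in X < _](sofR0 (k := k)) ltr_sofR. Qed.

Lemma rnormB V (x y : V) : rnorm (x - y) = rnorm (y - x).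
Proof. by rewrite -rnormN opprB. Qed.

Lemma rnorm_sum V (I : Type) (r : seq I) (P : pred I) (F : I -> V) :
  rnorm (\sum_(i <- r | P i) F i) <= \sum_(i <- r | P i) rnorm (F i).
Proof.
elim/big_rec2: _ => [|i y x _ h]; first by rewrite rnorm0.
by apply: le_trans (rnormD _ _) _; rewrite lerD2l.
Qed.

Lemma rnorm_sofR (a : R) : 0 <= a -> rnorm (sofR k a : K^o) = a.
Proof. by move=> a0; rewrite /rnorm ger0_norm ?sofR_ge0// sofRK. Qed.

Lemma bounded_opP X Y (T : {linear X -> Y}) :
  bounded_op X Y T <-> exists2 C : R, 0 <= C & forall x, rnorm (T x) <= C * rnorm x.
Proof.
split=> [/linear_bounded_continuous/linear_boundedP/pinfty_ex_gt0[r r0 h]|[C C0 h]].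
  exists (sRe r); first by rewrite -sofR_ge0 sReK ltW.
  by move=> x; rewrite /rnorm -sReM ?(ltW r0)//; exact/ler_sRe/h.
apply/bounded_linear_continuous/linear_boundedP.
near=> r => x; rewrite !rnormE (@le_trans _ _ (sofR k C * sofR k (rnorm x)))//.
  by rewrite -sofRM ler_sofR.
rewrite ler_wpM2r ?sofR_ge0 ?rnorm_ge0//; near: r.
by apply: nbhs_pinfty_ge; rewrite ger0_real ?sofR_ge0.
Unshelve. all: by end_near. Qed.

Lemma opnorm_le X Y (T : X -> Y) (C : R) : 0 <= C ->
  (forall x, rnorm (T x) <= C * rnorm x) -> opnorm T <= C.
Proof.
move=> C0 h; apply: ge_sup; first by exists (rnorm (T 0)); exists 0; rewrite //= rnorm0.
by move=> _ [x /= x1 <-]; apply: le_trans (h x) _; rewrite ler_piMr.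
Qed.

Lemma opnorm_ge0 X Y (T : X -> Y) : 0 <= opnorm T.
Proof.
rewrite /opnorm; set A := [set _ | _ in _]; have [hs|/sup_out->//] := pselect (has_sup A).
apply: (@le_trans _ _ (rnorm (T 0))); first exact: rnorm_ge0.
by apply: sup_upper_bound => //; exists 0; rewrite //= rnorm0.
Qed.

(** Some bound [C] has to be known first, since [sup] of an unbounded set is 0 by convention;
    scaling x to norm one then gives the constant [opnorm T]. *)
Lemma le_opnorm X Y (T : X -> Y) (C : R) : 0 <= C ->
  (forall (a : K) x, T (a *: x) = a *: T x) ->
  (forall x, rnorm (T x) <= C * rnorm x) ->
  forall x, rnorm (T x) <= opnorm T * rnorm x.
Proof.
move=> C0 TZ h x; have [x0|x0] := eqVneq (rnorm x) 0.
  by apply: le_trans (h x) _; rewrite x0 !mulr0.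
have {}x0 : 0 < rnorm x by rewrite lt_neqAle eq_sym x0 rnorm_ge0.
rewrite -ler_pdivrMr//.
have -> : rnorm (T x) / rnorm x = rnorm (T (sofR k (rnorm x)^-1 *: x)).
  by rewrite TZ rnormZ rnorm_sofR ?invr_ge0 ?rnorm_ge0// mulrC.
apply: ub_le_sup.
  exists C => _ [y /= y1 <-]; apply: le_trans (h y) _; by rewrite ler_piMr.
exists (sofR k (rnorm x)^-1 *: x) => //=.
by rewrite rnormZ rnorm_sofR ?invr_ge0 ?rnorm_ge0// mulVf// gt_eqF.
Qed.

Lemma closed_rnorm V (A : set V) :
  (forall x, (forall e : R, 0 < e -> exists2 y, A y & rnorm (x - y) < e) -> A x) ->
  closed A.
Proof.
move=> h x clx; apply: h => e e0.
have [y [Ay]] := clx _ (nbhsx_ballx x (sofR k e) (etrans (sofR_gt0 e) e0)).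
rewrite -ball_normE /= => xy; exists y => //.
by rewrite -(sofRK (k := k) e); exact: ltr_sRe.
Qed.

End Operators.

(** * Compactness through ultrafilters *)

Section FilterCauchy.
Context {R : realType} {k : scalar_kind}.
Local Notation K := (scalars R k).
Implicit Types X Y V : normedModType K.

(** The image of [F] under [f] is a Cauchy filter, expressed with real radii. *)
Definition cauchy_along {T : Type} {V : normedModType K} (F : set_system T)
    (f : T -> V) :=
  forall e : R, 0 < e -> exists2 A, F A & forall x y, A x -> A y -> rnorm (f x - f y) <= e.

Lemma ultra_bounded_real (T : Type) (F : set_system T) (h : T -> R) (B : set T) (M : R) :
  UltraFilter F -> F B -> (forall x, B x -> `|h x| <= M) ->
  forall e : R, 0 < e -> exists2 A, F A & forall x y, A x -> A y -> `|h x - h y| <= e.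
Proof.
move=> FU FB hM e e0.
(* The thresholds that [h] reaches on a set of [F]; their supremum is the limit of [h] along [F]. *)
pose D := [set t : R | F [set x | t <= h x]].
have D0 : D (- M).
  by apply: filterS FB => x /hM; rewrite ler_norml => /andP[].
have ubD : ubound D M.
  move=> t Dt; have [x [/= tx Bx]] := filter_ex (filterI Dt FB).
  by apply: le_trans tx _; have := hM _ Bx; rewrite ler_norml => /andP[].
have sD : has_sup D by split; [exists (- M) | exists M].
have e20 : 0 < e / 2 by rewrite divr_gt0.
have [t Dt st] := sup_adherent e20 sD.
exists ([set x | t <= h x] `&` ~` [set x | sup D + e / 2 <= h x]).
  apply: filterI => //.
  have [Fs|//] := in_ultra_setVsetC [set x | sup D + e / 2 <= h x] FU.
  have := ub_le_sup (proj2 sD) (Fs : D _).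
  by rewrite gerDl leNgt e20.
have H x : t <= h x -> ~ (sup D + e / 2 <= h x) ->
    sup D - e / 2 <= h x <= sup D + e / 2.
  move=> tx /negP; rewrite -ltNge => /ltW ->; rewrite andbT.
  exact: le_trans (ltW st) tx.
move=> x y [/= /H{}/[apply] /andP[x1 x2]] [/= /H{}/[apply] /andP[y1 y2]].
by rewrite ler_norml; apply/andP; split; lra.
Qed.

Section Along.
Context {T : Type} (F : set_system T) {FF : Filter F}.

Lemma cauchy_alongD V (f g : T -> V) :
  cauchy_along F f -> cauchy_along F g -> cauchy_along F (fun x => f x + g x).
Proof.
move=> hf hg e e0; have e20 : 0 < e / 2 by rewrite divr_gt0.
have [A FA hA] := hf _ e20; have [B FB hB] := hg _ e20.
exists (A `&` B); first exact: filterI.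
move=> x y [Ax Bx] [Ay By]; rewrite opprD addrACA (splitr e).
by apply: le_trans (rnormD _ _) _; rewrite lerD ?hA ?hB.
Qed.

Lemma cauchy_along_sum V n (f : 'I_n -> T -> V) :
  (forall i, cauchy_along F (f i)) -> cauchy_along F (fun x => \sum_(i < n) f i x).
Proof.
elim: n f => [|n IH] f hf.
  move=> e e0; exists setT; first exact: filterT.
  by move=> x y _ _; rewrite !big_ord0 subr0 rnorm0 ltW.
under [X in cauchy_along F X]eq_fun do rewrite big_ord_recr/=.
by apply: cauchy_alongD => //; apply: IH.
Qed.

Lemma cauchy_alongZ V (f : T -> K^o) (v : V) :
  cauchy_along F f -> cauchy_along F (fun x => (f x : K) *: v).
Proof.
move=> hf e e0; pose d := e / (rnorm v + 1).
have v1 : 0 < rnorm v + 1 by rewrite ltr_wpDl ?rnorm_ge0.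
have [A FA hA] := hf d (divr_gt0 e0 v1); exists A => // x y Ax Ay.
rewrite -scalerBl rnormZ; apply: le_trans (_ : d * rnorm v <= _).
  by rewrite ler_wpM2r ?rnorm_ge0 ?hA.
by rewrite /d mulrAC ler_pdivrMr// ler_wpM2l ?(ltW e0)// lerDl.
Qed.

Lemma cauchy_along_approx V (f : T -> V) :
  (forall e : R, 0 < e -> exists (g : T -> V) A, [/\ cauchy_along F g, F A &
     forall x, A x -> rnorm (f x - g x) <= e]) ->
  cauchy_along F f.
Proof.
move=> h e e0; have e30 : 0 < e / 3 by rewrite divr_gt0.
have [g [A [hg FA fg]]] := h _ e30; have [B FB hB] := hg _ e30.
exists (A `&` B); first exact: filterI.
move=> x y [Ax Bx] [Ay By].
have -> : f x - f y = (f x - g x) + ((g x - g y) + (g y - f y)).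
  by rewrite !addrA subrK addrNK.
apply: le_trans (rnormD _ _) _.
have := rnormD (g x - g y) (g y - f y).
have := fg _ Ax; have := fg _ Ay; have := hB _ _ Bx By.
by rewrite (rnormB (g y)); lra.
Qed.

End Along.

Lemma ultra_bounded_cauchy (T : Type) (F : set_system T) (f : T -> K^o) (B : set T)
    (M : R) : UltraFilter F -> F B -> (forall x, B x -> rnorm (f x) <= M) ->
  cauchy_along F f.
Proof.
move=> FU FB hM e e0; have e20 : 0 < e / 2 by rewrite divr_gt0.
have [A1 FA1 h1] := @ultra_bounded_real T F (fun x => sRe (f x)) B M FU FB
  (fun x Bx => le_trans (sRe_le_norm _) (hM x Bx)) _ e20.
have [A2 FA2 h2] := @ultra_bounded_real T F (fun x => sIm (f x)) B M FU FB
  (fun x Bx => le_trans (sIm_le_norm _) (hM x Bx)) _ e20.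
exists (A1 `&` A2); first exact: filterI.
move=> x y [x1 x2] [y1 y2]; apply: le_trans (norm_le_sReIm _) _.
by rewrite sReB sImB (splitr e) lerD ?h1 ?h2.
Qed.

Lemma ultra_rank_cauchy (T : Type) (F : set_system T) V n (l : 'I_n -> T -> K^o)
    (v : 'I_n -> V) (B : set T) (M : R) : UltraFilter F -> F B ->
  (forall i x, B x -> rnorm (l i x) <= M) ->
  cauchy_along F (fun x => \sum_(i < n) (l i x : K) *: v i).
Proof.
move=> FU FB hM; apply: cauchy_along_sum => i; apply: cauchy_alongZ.
exact: ultra_bounded_cauchy (hM i).
Qed.

(** It has to be shown that an ultrafilter [G] containing the closure of the image converges. As [G]
    need not contain the image itself, it is pulled back to the domain only up to small errors. *)
Lemma precompact_ultra (X : Type) (Y : completeNormedModType K) (T : X -> Y) (B : set X) :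
  (forall F : set_system X, UltraFilter F -> F B -> cauchy_along F T) ->
  precompact (T @` B).
Proof.
move=> h; rewrite precompactE compact_ultra => G GU GB.
pose D := [set De : set Y * R | G De.1 /\ 0 < De.2].
pose N (De : set Y * R) := B `&` [set x | exists2 y, De.1 y & rnorm (T x - y) <= De.2].
have NF : ProperFilter (filter_from D N).
  apply: filter_from_proper.
    apply: filter_from_filter; first by exists (setT, 1); split => //=; exact: filterT.
    move=> [A d] [A' d'] [/= GA d0] [/= GA' d'0].
    exists (A `&` A', Num.min d d').
      by split; [exact: filterI | rewrite /= lt_min d0].
    move=> x [Bx [y /= [Ay A'y]]]; rewrite le_min => /andP[yd yd'].
    by split; split => //; exists y.
  move=> [A d] [/= GA d0].
  have [y [Ay cy]] := filter_ex (filterI GA GB).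
  have d0' : 0 < sofR k d by rewrite sofR_gt0.
  have [_ [[x Bx <-]]] := cy _ (nbhsx_ballx y _ d0').
  rewrite -ball_normE /= => yx; exists x; split => //; exists y => //.
  by rewrite rnormB -(sofRK (k := k) d) ler_sRe// ltW.
(* F is an ultrafilter on the domain whose image is close to G. *)
have [F [FU NFF]] := ultraFilterLemma NF.
have NinF A d : G A -> 0 < d -> F (N (A, d)).
  by move=> GA d0; apply: NFF; exists (A, d).
have FB : F B by apply: filterS (NinF setT 1 _ _) => //; [move=> x [] | exact: filterT].
have cT := h F FU FB.
have cG : cauchy G.
  apply/cauchy_ballP => e e0.
  have re0 : 0 < sRe e by rewrite -(sofRK (k := k) 0) sofR0 ltr_sRe.
  have e40 : 0 < sRe e / 4 by rewrite divr_gt0.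
  have [A FA hA] := cT _ e40.
  (* If this neighbourhood of the image of [A] were not in [G], its complement would be, and [F]
     would provide a point of [A] mapped close to that complement. *)
  pose C := [set y | exists2 x, A x & rnorm (T x - y) <= sRe e / 4].
  have GC : G C.
    have [//|GnC] := in_ultra_setVsetC C GU.
    have [x [Ax [Bx [y nCy xy]]]] := filter_ex (filterI FA (NinF _ _ GnC e40)).
    by exfalso; apply: nCy; exists x.
  exists (C, C) => //= -[y z] [/= [x Ax xy] [x' Ax' x'z]].
  rewrite -ball_normE /= -[`|_|]sReK// -[ltRHS](sReK (ltW e0)) ltr_sofR -/(rnorm _).
  have -> : y - z = (y - T x) + ((T x - T x') + (T x' - z)).
    by rewrite !addrA subrK addrNK.
  have := rnormD (y - T x) ((T x - T x') + (T x' - z)).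
  have := rnormD (T x - T x') (T x' - z).
  have := hA _ _ Ax Ax'.
  by rewrite (rnormB y); lra.
have /cvg_ex[l Gl] : cvg G by exact: cauchy_cvg.
exists l; split => //.
have : closed (closure (T @` B)) by exact: closed_closure.
move=> /(_ l); apply => A Al.
have [y [Ay By]] := filter_ex (filterI (Gl _ Al) GB).
by exists y.
Qed.

End FilterCauchy.

(** * Closed linear spans *)

Section ClosedSpan.
Context {R : realType} {k : scalar_kind}.
Local Notation K := (scalars R k).

Lemma closed_rnormP {V : normedModType K} (A : set V) x : closed A ->
  (forall e : R, 0 < e -> exists2 y, A y & rnorm (x - y) < e) -> A x.
Proof.
move=> cA h; apply: cA => B /nbhs_ballP[e /= e0 eB].
have re0 : 0 < sRe e by rewrite -(sofRK (k := k) 0) sofR0 ltr_sRe.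
have [y Ay xy] := h _ re0; exists y; split => //; apply: eB.
by rewrite -ball_normE /= -[`|_|]sReK// -[ltRHS](sReK (ltW e0)) ltr_sofR.
Qed.

Context {V : completeNormedModType K} {I : Type} (e : I -> V).

(** An intersection of closed sets stable under linear combinations, so that the induction principle
    [cspan_ind] is immediate. *)
Definition cspan_pred : {pred V} := [pred x | `[< forall A : set V, closed A ->
  A 0 -> (forall (a : K) y z, A y -> A z -> A (a *: y + z)) ->
  (forall i, A (e i)) -> A x >]].

Lemma cspan_ind (A : set V) x : x \in cspan_pred -> closed A ->
  A 0 -> (forall (a : K) y z, A y -> A z -> A (a *: y + z)) ->
  (forall i, A (e i)) -> A x.
Proof. by move=> /asboolP; exact. Qed.

Lemma cspan_submod : submod_closed cspan_pred.
Proof.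
split; first exact/asboolP.
move=> a x y hx hy; apply/asboolP => A cA A0 Al Ae; apply: (Al).
  exact: (cspan_ind hx cA A0 Al Ae).
exact: (cspan_ind hy cA A0 Al Ae).
Qed.

Lemma cspan_closed : closed [set` cspan_pred].
Proof.
move=> x clx; apply/asboolP => A cA A0 Al Ae; apply: (cA) => B /clx[y [hy By]].
by exists y; split => //; exact: (cspan_ind hy cA A0 Al Ae).
Qed.

Definition cspan : closedSubspace V := ClosedSubspace cspan_submod cspan_closed.

Lemma cspan_gen i : e i \in cs_pred cspan.
Proof. exact/asboolP. Qed.

End ClosedSpan.

(** * Coordinates on sequence spaces and their subspaces *)

Section EllBasics.
Context {R : realType} {k : scalar_kind} {p : R} {p1 : 1 <= p}.
Local Notation K := (scalars R k).
Local Notation lp := (ell k p1).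

Let p0 : 0 < p. Proof. exact: lt_le_trans p1. Qed.

Definition ell_coord (m : nat) (x : lp) : K^o := x m.

Fact ell_coord_linear m : linear (ell_coord m).
Proof. by []. Qed.
HB.instance Definition _ m :=
  GRing.isLinear.Build K lp K^o *:%R (ell_coord m) (ell_coord_linear m).

Lemma ell_coord_sum m (I : Type) (r : seq I) (P : pred I) (F : I -> lp) :
  (\sum_(i <- r | P i) F i : lp) m = \sum_(i <- r | P i) F i m.
Proof. exact: (linear_sum (ell_coord m)). Qed.

Lemma ell_coord_le m (x : lp) : rnorm (x m) <= rnorm x.
Proof. by rewrite -lee_fin ell_rnormE lnorm_ge_coord. Qed.

Lemma rnorm_ell_le (x : lp) (e : R) : 0 <= e ->
  (forall N, \sum_(0 <= n < N) rnorm (x n) `^ p <= e `^ p) -> rnorm x <= e.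
Proof. by move=> e0 h; rewrite -lee_fin ell_rnormE; apply/lnorm_leP. Qed.

Lemma ell_ext (x y : lp) : (forall n, x n = y n) -> x = y.
Proof. by move=> xy; apply/val_inj/funext. Qed.

Fact delta_subproof (m : nat) :
  (fun n => (n == m)%:R : K^o) \in @ell_pred R k p.
Proof.
rewrite inE /=; apply: (@le_lt_trans _ _ 1%:E); last by rewrite ltry.
apply/lnorm_leP => // N; rewrite powR1.
have h n : rnorm ((n == m)%:R : K^o) `^ p = (n == m)%:R.
  case: eqP => _; last by rewrite rnorm0 powR0// gt_eqF.
  have -> : rnorm (true%:R : K^o) = 1 by rewrite /rnorm normr1; case: (k).
  by rewrite powR1.
under eq_bigr do rewrite h.
suff -> : \sum_(0 <= n < N) ((n == m)%:R : R) = (m < N)%:R by case: (m < N)%N.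
elim: N => [|N IH]; first by rewrite big_geq.
by rewrite big_nat_recr//= IH ltnS; case: ltngtP; rewrite /= ?(addr0, add0r).
Qed.

Definition ell_delta m : lp := Ell p1 (delta_subproof m).

End EllBasics.

Section SubspaceCoordinates.
Context {R : realType} {k : scalar_kind} {q : R} {q1 : 1 <= q}.
Local Notation K := (scalars R k).
Context {Y : closedSubspace (ell k q1)}.

Definition cs_coord (m : nat) (y : Y) : K^o := cs_val y m.

Fact cs_val_linear : linear (@cs_val K (ell k q1) Y).
Proof. by []. Qed.

Fact cs_coord_linear m : linear (cs_coord m).
Proof. by move=> a x y; rewrite /cs_coord cs_val_linear; exact: ell_coord_linear. Qed.
HB.instance Definition _ m :=
  GRing.isLinear.Build K Y K^o *:%R (cs_coord m) (cs_coord_linear m).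

Lemma cs_rnormE (y : Y) : rnorm y = rnorm (cs_val y).
Proof. by []. Qed.

Lemma cs_coord_le (y : Y) m : rnorm (cs_coord m y) <= rnorm y.
Proof. exact: (ell_coord_le m (cs_val y)). Qed.

Lemma cs_coord0 (y : Y) : (forall m, cs_coord m y = 0) -> y = 0.
Proof. by move=> y0; apply/val_inj/ell_ext. Qed.

End SubspaceCoordinates.

(** * Operators of finite rank *)

Section FiniteRank.
Context {R : realType} {k : scalar_kind} {q : R} {q1 : 1 <= q}.
Local Notation K := (scalars R k).
Context {X : normedModType K} {Y : closedSubspace (ell k q1)}.

(** [finite_rank] provides coefficients for each x separately, with no regularity in x. Coordinates
    of [ell] play the role of Hahn-Banach functionals in making them linear and bounded. *)
Lemma finite_rank_coords (n : nat) (T : X -> Y) (b : 'I_n -> Y) (C : R) : 0 <= C ->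
  (forall (a : K) x y, T (a *: x + y) = a *: T x + T y) ->
  (forall x, rnorm (T x) <= C * rnorm x) ->
  (forall x, exists c : 'I_n -> K, T x = \sum_(i < n) c i *: b i) ->
  exists m (l : 'I_m -> X -> K^o) (v : 'I_m -> Y) (M : R),
  [/\ 0 <= M, forall i (a : K) x y, l i (a *: x + y) = a *: l i x + l i y,
      forall i x, rnorm (l i x) <= M * rnorm x &
      forall x, T x = \sum_(i < m) (l i x : K) *: v i].
Proof.
(* Subtract from T its coordinate m times a multiple of one spanning vector;
   the remaining ones then span the range. *)
elim: n T b C => [|n IH] T b C C0 Tlin Tbd Tb.
  exists 0, (fun _ _ => 0), (fun _ => 0), 0; split => // [[]|[]|x]//.
  by have [c ->] := Tb x; rewrite !big_ord0.
have [b0|b0] := pselect (forall m, cs_coord m (b ord0) = 0).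
  apply: (IH T (fun i => b (lift ord0 i)) C) => // x.
  have [c ->] := Tb x; exists (fun i => c (lift ord0 i)).
  rewrite big_ord_recl (_ : b ord0 = 0) ?scaler0 ?add0r//.
  exact: cs_coord0.
move/existsNP : b0 => [m /eqP b0].
pose y0 : Y := (cs_coord m (b ord0) : K)^-1 *: b ord0.
pose T' x := T x - (cs_coord m (T x) : K) *: y0.
pose M0 := C + C * rnorm y0.
have [||||m' [l [v [M [M_ge0 llin lbd Tl]]]]] :=
    IH T' (fun i => b (lift ord0 i) - (cs_coord m (b (lift ord0 i)) : K) *: y0) M0.
- by rewrite addr_ge0 ?mulr_ge0 ?rnorm_ge0.
- move=> a x y; rewrite /T' Tlin.
  rewrite (cs_coord_linear m) [_ *: cs_coord m (T x)]/(_ * _).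
  by rewrite scalerDl -scalerA opprD addrACA -scalerBr.
- move=> x; apply: le_trans (rnormD _ _) _; rewrite rnormN mulrDl lerD//.
  rewrite rnormZ mulrAC ler_wpM2r ?rnorm_ge0//.
  exact: le_trans (cs_coord_le _ _) (Tbd _).
- move=> x; have [c Tc] := Tb x; exists (fun i => c (lift ord0 i)).
  have H : T' x = \sum_(i < n.+1) c i *: (b i - (cs_coord m (b i) : K) *: y0).
    have e : cs_coord m (T x) = \sum_(i < n.+1) c i * (cs_coord m (b i) : K).
      by rewrite Tc linear_sum; apply: eq_bigr => i _; rewrite linearZ.
    under [RHS]eq_bigr do rewrite scalerBr scalerA.
    by rewrite sumrB -scaler_suml -Tc -e.
  rewrite H big_ord_recl /y0 scalerA mulfV// scale1r subrr scaler0 add0r.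
  by [].
pose l' (i : 'I_m'.+1) := if unlift ord0 i is Some j then l j
  else fun x => cs_coord m (T x).
pose v' (i : 'I_m'.+1) := if unlift ord0 i is Some j then v j else y0.
exists m'.+1, l', v', (M + C); split.
- by rewrite addr_ge0.
- by move=> i a x y; rewrite /l'; case: unliftP => [j _|_]; rewrite ?llin ?Tlin ?linearP.
- move=> i x; rewrite /l' mulrDl; case: unliftP => [j _|_].
    by apply: le_trans (lbd _ _) _; rewrite lerDl mulr_ge0 ?rnorm_ge0.
  apply: le_trans (cs_coord_le _ _) _; apply: le_trans (Tbd _) _.
  by rewrite lerDr mulr_ge0 ?rnorm_ge0.
- move=> x; rewrite big_ord_recl /l' /v' unlift_none.
  under eq_bigr do rewrite liftK.
  by rewrite -Tl /T' addrC subrK.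
Qed.

(** Bounded coefficients converge along an ultrafilter containing the unit ball, so finite-rank
    operators are Cauchy along it, and uniform limits on the ball inherit this. *)
Lemma approximable_compact : approximable X Y `<=` compact_op X Y.
Proof.
move=> T [Tb happ]; split => //; apply: precompact_ultra => F FU FB.
apply: cauchy_along_approx => e e0.
have [S [Sb [n [b Sn]]] TSe] := happ _ e0.
have [C C0 hS] := (bounded_opP S).1 Sb.
have [D D0 hT] := (bounded_opP T).1 Tb.
have [|m [l [v [M [M0 llin lbd Sl]]]]] := @finite_rank_coords n S b C C0 _ hS Sn.
  by move=> a x y; rewrite linearP.
exists S, [set x | rnorm x <= 1]; split => //.
  rewrite (_ : (S : X -> Y) = fun x => \sum_(i < m) (l i x : K) *: v i); last first.
    exact/funext.
  apply: (@ultra_rank_cauchy _ _ _ _ _ _ _ _ _ M FU FB) => i x /= x1; apply: le_trans (lbd i x) _.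
  by rewrite ler_piMr.
move=> x /= x1; apply: le_trans (ltW TSe).
apply: ub_le_sup; last by exists x.
exists (D + C) => _ [y /= y1 <-]; apply: le_trans (rnormD _ _) _.
by rewrite rnormN lerD//; [apply: le_trans (hT y) _|apply: le_trans (hS y) _];
  rewrite ler_piMr.
Qed.

End FiniteRank.

(** * Levels of coordinates *)

(** The points of all levels are placed in [nat] by the encoding of a countable type; their order
    there is irrelevant. *)
Definition node n (g : base n) : nat := pickle (Tagged base g : {n & base n}).

(* None on the integers that encode no point, where all vectors below vanish. *)
Definition level (m : nat) : option nat :=
  omap tag (pickle_inv m : option {n & base n}).

Lemma node_inj n : injective (@node n).
Proof. by move=> g h /(pcan_inj pickleK) /eqP; rewrite eq_Tagged => /eqP. Qed.

Lemma level_node n (g : base n) : level (node g) = Some n.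
Proof. by rewrite /level /node pickleK_inv. Qed.

Lemma level_some m n : level m = Some n -> exists g : base n, m = node g.
Proof.
rewrite /level; case E : (pickle_inv m) => [[l g]|//] /= [ln]; subst l.
exists g; rewrite /node.
by have := @pickle_invK {i : nat & base i} m; rewrite E.
Qed.

Section Levels.
Context {R : realType}.

(** The first N integers meet finitely many levels, so a partial sum of nonnegative terms is
    dominated by a sum over whole levels. *)
Lemma sum_levels (F : nat -> R) (N : nat) :
  (forall m, 0 <= F m) -> (forall m, level m = None -> F m = 0) ->
  exists L, \sum_(0 <= m < N) F m <= \sum_(0 <= l < L) \sum_(g : base l) F (node g).
Proof.
move=> F0 Fj.
exists (\max_(m < N) (odflt 0%N (level m)).+1)%N.
set L := (\max_(_ < N) _)%N.
pose D m l (g : base l) := if node g == m then F (node g) else 0.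
have h m : (m < N)%N -> F m <= \sum_(0 <= l < L) \sum_(g : base l) D m l g.
  move=> mN; have D0 l : 0 <= \sum_(g : base l) D m l g.
    by apply: sumr_ge0 => g _; rewrite /D; case: ifP.
  case E : (level m) => [l|]; last by rewrite Fj// sumr_ge0.
  have [g mg] := level_some E.
  have lL : (l < L)%N.
    by have := @leq_bigmax _ (fun m : 'I_N => (odflt 0%N (level m)).+1) (Ordinal mN);
      rewrite /= E.
  apply: (@le_trans _ _ (\sum_(g : base l) D m l g)); last first.
    by rewrite big_mkord (bigD1 (Ordinal lL))//= lerDl sumr_ge0// => i _; exact: D0.
  apply: (@le_trans _ _ (D m l g)); first by rewrite /D mg eqxx.
  by rewrite [leRHS](bigD1 g)//= lerDl sumr_ge0// => h _; rewrite /D; case: ifP.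
rewrite big_mkord; apply: le_trans (ler_sum _ (fun (i : 'I_N) _ => h i (ltn_ord i))) _.
rewrite exchange_big/= ler_sum// => l _; rewrite exchange_big/= ler_sum// => g _.
rewrite /D -big_mkcond/=.
have [gN|Ng] := ltnP (node g) N.
  by rewrite (big_pred1 (Ordinal gN))// => i; rewrite -val_eqE eq_sym.
rewrite big_pred0// => i; apply/negbTE; rewrite neq_ltn orbC.
by rewrite (leq_trans (ltn_ord i)).
Qed.

Definition weight (t : R) (m : nat) : R := if level m is Some n then t ^+ n else 0.

Lemma weight_node t n (g : base n) : weight t (node g) = t ^+ n.
Proof. by rewrite /weight level_node. Qed.

Lemma weight_ge0 t m : 0 <= t -> 0 <= weight t m.
Proof. by move=> t0; rewrite /weight; case: level => // n; rewrite exprn_ge0. Qed.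

Lemma weight_le1 t m : 0 <= t <= 1 -> weight t m <= 1.
Proof.
by move=> /andP[t0 t1]; rewrite /weight; case: level => // n; rewrite exprn_ile1.
Qed.

Lemma weightM t u m : weight (t * u) m = weight t m * weight u m.
Proof. by rewrite /weight; case: level => [n|]; rewrite ?exprMn ?mulr0. Qed.

Lemma weight_powR t s m : 0 < s -> 0 <= t -> weight (t `^ s) m = weight t m `^ s.
Proof.
move=> s0 t0; rewrite /weight; case: level => [n|]; last by rewrite powR0 ?gt_eqF.
by rewrite -powR_mulrn ?powR_ge0// -powRrM mulrC powRrM powR_mulrn.
Qed.

Lemma geometric_le (t : R) n : 0 <= t < 1 -> \sum_(0 <= i < n) t ^+ i <= (1 - t)^-1.
Proof.
move=> /andP[t0 t1]; rewrite -[leRHS]mul1r ler_pdivlMr ?subr_gt0// mulrC big_mkord.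
have -> : (1 - t) * \sum_(i < n) t ^+ i = 1 - t ^+ n.
  by rewrite -opprB mulNr -subrX1 opprB.
by rewrite gerBl exprn_ge0.
Qed.

(** Level n has 2 * 4^n points, which gives a geometric series of ratio 4 t. *)
Lemma sum_weight_le (t : R) N : 0 <= t -> 4 * t < 1 ->
  \sum_(0 <= m < N) weight t m <= 2 / (1 - 4 * t).
Proof.
move=> t0 t1; have [L] := sum_levels N (fun m => weight_ge0 m t0)
  (fun m e => ltac:(by rewrite /weight e)).
move/le_trans; apply.
have -> : \sum_(0 <= l < L) \sum_(g : base l) weight t (node g) =
    2 * \sum_(0 <= l < L) (4 * t) ^+ l.
  rewrite mulr_sumr; apply: eq_bigr => l _.
  under eq_bigr do rewrite weight_node.
  by rewrite sumr_const card_base -[LHS]mulr_natl natrM natrX exprMn mulrA.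
by rewrite ler_wpM2l// geometric_le// mulr_ge0.
Qed.

End Levels.

Section SmallSupport.
Context {R : realType} {k : scalar_kind} {p : R} {p1 : 1 <= p}.
Local Notation K := (scalars R k).
Local Notation lp := (ell k p1).

Let p0 : 0 < p. Proof. exact: lt_le_trans p1. Qed.

(** The three levels have 2 * (1 + 4 + 16) * 4^n = 42 * 4^n points. The factor 42 may stand outside
    the root because 42 <= 42^p. *)
Lemma rnorm_three_levels (x : lp) n (M : R) : 0 <= M ->
  (forall m, level m = None -> x m = 0) ->
  (forall l (g : base l), ~~ (n <= l <= n.+2)%N -> x (node g) = 0) ->
  (forall l (g : base l), (n <= l <= n.+2)%N -> rnorm (x (node g)) <= M) ->
  rnorm x <= 42 * (4 `^ p^-1) ^+ n * M.
Proof.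
move=> M0 xj xout xin.
have c0 : 0 <= 4 `^ p^-1 :> R by exact: powR_ge0.
apply: rnorm_ell_le => [|N]; first by rewrite !mulr_ge0 ?exprn_ge0.
have [L] := @sum_levels R (fun m => rnorm (x m) `^ p) N (fun=> powR_ge0 _ _)
  (fun m e => ltac:(by rewrite /= xj// rnorm0 powR0// gt_eqF)).
move/le_trans; apply.
have H l : \sum_(g : base l) rnorm (x (node g)) `^ p <=
    if (n <= l <= n.+2)%N then 2 * 4 ^+ l * M `^ p else 0.
  case: ifPn => nl; last by rewrite big1// => g _; rewrite xout// rnorm0 powR0// gt_eqF.
  apply: (@le_trans _ _ (\sum_(g : base l) M `^ p)).
    apply: ler_sum => g _; apply: ge0_ler_powR (xin _ _ nl);
      by rewrite ?nnegrE ?rnorm_ge0// ltW.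
  by rewrite sumr_const card_base -[leLHS]mulr_natl natrM natrX.
apply: le_trans (ler_sum _ (fun l _ => H l)) _.
apply: (@le_trans _ _ (42 * 4 ^+ n * M `^ p)).
  apply: (@le_trans _ _ (\sum_(0 <= l < n.+3 + L)
      if (n <= l <= n.+2)%N then 2 * 4 ^+ l * M `^ p else 0)).
    rewrite (@big_cat_nat _ _ _ L 0%N (n.+3 + L)%N) ?leq_addl//= lerDl.
    by rewrite sumr_ge0// => l _; case: ifP => // _; rewrite !mulr_ge0 ?exprn_ge0 ?powR_ge0.
  rewrite (@big_cat_nat _ _ _ n.+3 0%N (n.+3 + L)%N) ?leq_addr//=.
  rewrite [X in _ + X]big_nat_cond [X in _ + X]big1 ?addr0; last first.
    move=> l /andP[/andP[l1 _] _]; rewrite ifF//; apply/negbTE.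
    by rewrite negb_and -!ltnNge l1 orbT.
  rewrite (@big_cat_nat _ _ _ n 0%N n.+3) ?leqW//=.
  rewrite big_nat_cond big1 ?add0r; last first.
    move=> l /andP[/andP[_ l1] _]; rewrite ifF//; apply/negbTE.
    by rewrite negb_and -!ltnNge l1.
  rewrite !big_nat_recr ?leqnSn ?(leqW (leqnSn n))//=.
  rewrite big_geq// !leqnn/= !exprS add0r.
  have : 0 <= 4 ^+ n * M `^ p by rewrite mulr_ge0 ?exprn_ge0 ?powR_ge0.
  move: (4 ^+ n) (M `^ p) => a b ab; lra.
rewrite !powRM ?mulr_ge0 ?exprn_ge0//.
have -> : ((4 `^ p^-1) ^+ n) `^ p = 4 ^+ n.
  by rewrite -(powR_mulrn _ c0) -!powRrM mulrCA mulVf ?gt_eqF// mulr1 powR_mulrn.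
rewrite ler_wpM2r ?powR_ge0// ler_wpM2r ?exprn_ge0//.
by rewrite -[leLHS]powRr1// ler_powR// ler1n.
Qed.

End SmallSupport.

(** * Norms of scalars and averages *)

Section ScalarFacts.
Context {R : realType} {k : scalar_kind}.
Local Notation K := (scalars R k).

Lemma sofR_nat n : sofR k (n%:R : R) = n%:R.
Proof.
by elim: n => [|n IH]; rewrite ?sofR0// -!natr1 sofRD IH; congr (_ + _); case: (k).
Qed.

Lemma sofR1 : sofR k (1 : R) = 1. Proof. exact: (sofR_nat 1). Qed.

Lemma sofRV (a : R) : a != 0 -> sofR k a^-1 = (sofR k a)^-1.
Proof.
move=> a0; have H : sofR k a * sofR k a^-1 = 1 by rewrite -sofRM mulfV ?sofR1.
have A0 : sofR k a != 0.
  by apply: contra_eq_neq H => ->; rewrite mul0r eq_sym oner_eq0.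
by apply: (mulfI A0); rewrite H mulfV.
Qed.

Lemma rnorm_natV n : rnorm ((n%:R : K)^-1 : K^o) = n%:R^-1.
Proof.
have [->|n0] := eqVneq n 0%N; first by rewrite !invr0 rnorm0.
by rewrite -sofR_nat -sofRV ?pnatr_eq0// rnorm_sofR ?invr_ge0.
Qed.

Lemma rnormM (x y : K) : rnorm (x * y : K^o) = rnorm (x : K^o) * rnorm (y : K^o).
Proof. exact: (@rnormZ _ _ K^o x y). Qed.

Lemma rnorm_unit (x : K) : `|x| = 1 -> rnorm (x : K^o) = 1.
Proof. by rewrite /rnorm => ->; rewrite -sofR1 sofRK. Qed.

Lemma rnorm_le_nat (x : K) n : `|x| <= n%:R -> rnorm (x : K^o) <= n%:R.
Proof. by move=> h; rewrite -(ler_sofR (k := k)) -rnormE sofR_nat. Qed.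

Lemma rnorm_avg_le n (I : finType) (F : I -> K^o) (M : R) : #|I| = n -> (0 < n)%N ->
  (forall i, rnorm (F i) <= M) -> rnorm ((n%:R : K)^-1 * \sum_i F i : K^o) <= M.
Proof.
move=> In n0 h; rewrite rnormM rnorm_natV ler_pdivrMl ?ltr0n//.
apply: le_trans (rnorm_sum _ _ _) _.
apply: le_trans (ler_sum _ (fun i _ => h i)) _.
by rewrite sumr_const In mulr_natl.
Qed.

End ScalarFacts.

(** * Davie's subspaces *)

Section Basis.
Context {R : realType} {k : scalar_kind} {p : R} {p1 : 1 <= p}.
Local Notation K := (scalars R k).
Local Notation lp := (ell k p1).
Variable t : R.

Definition basis_vector (n : nat) (j : fibre n) : lp :=
  \sum_(g : base n) (sofR k (t ^+ n) * downsign j g : K) *: ell_delta (node g) +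
  \sum_(g : base n.+1) (sofR k (t ^+ n.+1) * upsign j g : K) *: ell_delta (node g).

Lemma ell_addE (x y : lp) m : (x + y) m = x m + y m. Proof. by []. Qed.

Lemma ell_linE (a : K) (x y : lp) m : (a *: x + y) m = a * (x m : K) + y m :> K.
Proof. exact: ell_coord_linear. Qed.

Lemma sum_delta n (c : base n -> K) m :
  (\sum_(g : base n) c g *: ell_delta (node g) : lp) m =
  \sum_(g : base n | node g == m) c g.
Proof.
rewrite ell_coord_sum [RHS]big_mkcond/=; apply: eq_bigr => g _.
transitivity (c g * (m == node g)%:R : K); first by [].
by rewrite eq_sym; case: eqP => _; rewrite ?mulr1 ?mulr0.
Qed.

Lemma sum_delta_node n (c : base n -> K) (h : base n) :
  (\sum_(g : base n) c g *: ell_delta (node g) : lp) (node h) = c h.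
Proof.
by rewrite sum_delta (big_pred1 h)// => g; rewrite /= (inj_eq (@node_inj n)).
Qed.

Lemma sum_delta_other n (c : base n -> K) m : level m != Some n ->
  (\sum_(g : base n) c g *: ell_delta (node g) : lp) m = 0.
Proof.
move=> mn; rewrite sum_delta big_pred0// => g; apply/negbTE.
by apply: contraNneq mn => <-; rewrite level_node.
Qed.

Lemma basis_vector_down n (j : fibre n) (h : base n) :
  basis_vector j (node h) = sofR k (t ^+ n) * downsign j h.
Proof.
rewrite ell_addE sum_delta_node sum_delta_other ?addr0//.
by rewrite level_node; apply/eqP => -[] /eqP; rewrite ltn_eqF.
Qed.

Lemma basis_vector_up n (j : fibre n) (h : base n.+1) :
  basis_vector j (node h) = sofR k (t ^+ n.+1) * upsign j h.
Proof.
rewrite ell_addE sum_delta_node sum_delta_other ?add0r//.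
by rewrite level_node; apply/eqP => -[] /eqP; rewrite gtn_eqF.
Qed.

Lemma basis_vector_out n (j : fibre n) m :
  level m != Some n -> level m != Some n.+1 -> basis_vector j m = 0.
Proof. by move=> m1 m2; rewrite ell_addE !sum_delta_other ?addr0. Qed.

Definition davie : closedSubspace lp :=
  cspan (fun i : {n & fibre n} => basis_vector (tagged i)).

Definition davie_vector n (j : fibre n) : davie :=
  CsElt (cspan_gen _ (Tagged fibre j)).

Hypothesis t_gt0 : 0 < t.

(* On davie both alpha and alpha' are the coefficient functional of
   basis_vector j, read on level n and on level n.+1. *)
Definition alpha n (j : fibre n) (x : lp) : K^o :=
  (#|{: base n}|%:R : K)^-1 * (sofR k (t ^+ n))^-1 *
    \sum_(g : base n) downsign j g * (x (node g) : K).

Definition alpha' n (j : fibre n) (x : lp) : K^o :=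
  (#|{: base n.+1}|%:R : K)^-1 * (sofR k (t ^+ n.+1))^-1 *
    \sum_(g : base n.+1) upsign j g * (x (node g) : K).

Let tn0 n : sofR k (t ^+ n) != 0.
Proof. by rewrite gt_eqF// sofR_gt0 exprn_gt0. Qed.

Let card0 n : (#|{: base n}|%:R : K) != 0.
Proof. by rewrite pnatr_eq0 card_base -lt0n muln_gt0 expn_gt0. Qed.

Lemma alpha_basis n (i j : fibre n) : alpha i (basis_vector j) = (i == j)%:R.
Proof.
rewrite /alpha; under eq_bigr do rewrite basis_vector_down mulrCA.
rewrite -mulr_sumr downsign_orth mulrA -[X in X * _]mulrA mulVf// mulr1.
by case: eqP => _; rewrite ?mulr0// mulVf.
Qed.

Lemma alpha'_basis n (i j : fibre n) : alpha' i (basis_vector j) = (i == j)%:R.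
Proof.
rewrite /alpha'; under eq_bigr do rewrite basis_vector_up mulrCA.
rewrite -mulr_sumr upsign_orth mulrA -[X in X * _]mulrA mulVf// mulr1.
by case: eqP => _; rewrite ?mulr0// mulVf.
Qed.

(** Supports overlap only for n = m + 1, where the up signs of block m meet the down signs of block
    n and are orthogonal to them. *)
Lemma alpha_basis_neq n m (i : fibre n) (j : fibre m) : n != m ->
  alpha i (basis_vector j) = 0.
Proof.
move=> nm; rewrite /alpha; have [e|nm1] := eqVneq n m.+1.
  subst n; under eq_bigr do rewrite basis_vector_up mulrCA mulrC -mulrA.
  under eq_bigr do rewrite [X in _ * X]mulrC mulrCA.
  by rewrite -mulr_sumr; under eq_bigr do rewrite mulrC;
    rewrite upsign_downsign_orth !mulr0.
rewrite big1 ?mulr0// => g _; rewrite basis_vector_out ?mulr0// level_node;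
  by apply/eqP => -[] /eqP; rewrite ?(negbTE nm) ?(negbTE nm1).
Qed.

Lemma alpha'_basis_neq n m (i : fibre n) (j : fibre m) : n != m ->
  alpha' i (basis_vector j) = 0.
Proof.
move=> nm; rewrite /alpha'; have [e|nm1] := eqVneq n.+1 m.
  subst m; under eq_bigr do rewrite basis_vector_down mulrCA.
  by rewrite -mulr_sumr upsign_downsign_orth !mulr0.
rewrite big1 ?mulr0// => g _; rewrite basis_vector_out ?mulr0// level_node;
  by apply/eqP => -[] /eqP; rewrite ?eqSS ?(negbTE nm) ?(negbTE nm1).
Qed.

Fact alpha_linear n (j : fibre n) : linear (alpha j).
Proof.
move=> a x y; rewrite /alpha; under eq_bigr do rewrite ell_linE mulrDr mulrCA.
by rewrite big_split/= -mulr_sumr mulrDr mulrCA.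
Qed.

Fact alpha'_linear n (j : fibre n) : linear (alpha' j).
Proof.
move=> a x y; rewrite /alpha'; under eq_bigr do rewrite ell_linE mulrDr mulrCA.
by rewrite big_split/= -mulr_sumr mulrDr mulrCA.
Qed.

HB.instance Definition _ n (j : fibre n) :=
  GRing.isLinear.Build K lp K^o *:%R (alpha j) (alpha_linear j).
HB.instance Definition _ n (j : fibre n) :=
  GRing.isLinear.Build K lp K^o *:%R (alpha' j) (alpha'_linear j).

Let rnorm_sofRV n : rnorm ((sofR k (t ^+ n))^-1 : K^o) = (t ^+ n)^-1.
Proof.
by rewrite -sofRV ?gt_eqF ?exprn_gt0// rnorm_sofR// invr_ge0 exprn_ge0// ltW.
Qed.

Let card_gt0 n : (0 < #|{: base n}|)%N.
Proof. by rewrite card_base muln_gt0 expn_gt0. Qed.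

Lemma alpha_le n (j : fibre n) x : rnorm (alpha j x) <= (t ^+ n)^-1 * rnorm x.
Proof.
rewrite /alpha mulrAC mulrC rnormM rnorm_sofRV.
rewrite ler_wpM2l ?invr_ge0 ?exprn_ge0 ?(ltW t_gt0)//.
apply: rnorm_avg_le => // g.
by rewrite rnormM (rnorm_unit (downsign_norm _ _)) mul1r ell_coord_le.
Qed.

Lemma alpha'_le n (j : fibre n) x : rnorm (alpha' j x) <= (t ^+ n.+1)^-1 * rnorm x.
Proof.
rewrite /alpha' mulrAC mulrC rnormM rnorm_sofRV.
rewrite ler_wpM2l ?invr_ge0 ?exprn_ge0 ?(ltW t_gt0)//.
apply: rnorm_avg_le => // g.
by rewrite rnormM (rnorm_unit (upsign_norm _ _)) mul1r ell_coord_le.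
Qed.

(** The two functionals agree on all basis vectors by orthogonality and are continuous, so they
    agree on the closed span. *)
Lemma alphaE n (j : fibre n) x : x \in cs_pred davie -> alpha j x = alpha' j x.
Proof.
move=> xD; apply: (cspan_ind (A := [set x | alpha j x = alpha' j x]) xD).
- apply: closed_rnorm => y hy /=; apply/eqP; rewrite -subr_eq0; apply/eqP.
  apply: (@rnorm0_eq0 R k K^o).
  apply/eqP; rewrite eq_le rnorm_ge0 andbT; apply/ler_addgt0Pr => e e0.
  pose C := (t ^+ n)^-1 + (t ^+ n.+1)^-1.
  have C0 : 0 < C by rewrite addr_gt0// invr_gt0 exprn_gt0.
  have [z /= az yz] := hy _ (divr_gt0 e0 C0).
  have -> : alpha j y - alpha' j y = alpha j (y - z) - alpha' j (y - z).
    by rewrite !linearB/= az opprK addrACA addNr addr0.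
  rewrite add0r; apply: le_trans (rnormD _ _) _; rewrite rnormN.
  apply: le_trans (lerD (alpha_le _ _) (alpha'_le _ _)) _.
  by rewrite -mulrDl mulrC -ler_pdivlMr// ltW.
- by rewrite /= !linear0.
- by move=> a y z /= hy hz; rewrite !linearP/= hy hz.
- case=> m i /=; have [e|nm] := eqVneq n m.
    by subst m; rewrite alpha_basis alpha'_basis.
  by rewrite alpha_basis_neq// alpha'_basis_neq.
Qed.

End Basis.

Section Trace.
Context {R : realType} {k : scalar_kind} {r q : R} {r1 : 1 <= r} {q1 : 1 <= q}.
Local Notation K := (scalars R k).
Variables a b : R.
Hypotheses (a_gt0 : 0 < a) (a_le1 : a <= 1) (b_gt0 : 0 < b).
Local Notation X := (@davie R k r r1 a).
Local Notation Y := (@davie R k q q1 b).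

(** * The trace functional *)

Definition average n (s : fibre n -> K) : X :=
  (((4 ^ n)%N%:R : K)^-1) *: \sum_(j : fibre n) s j *: (davie_vector a j : X).

Lemma average_map (V : lmodType K) (f : {linear X -> V}) n (s : fibre n -> K) :
  f (average s) =
  (((4 ^ n)%N%:R : K)^-1) *: \sum_(j : fibre n) s j *: f (davie_vector a j).
Proof.
by rewrite linearZ linear_sum; congr (_ *: _); apply: eq_bigr => j _; rewrite linearZ.
Qed.

Lemma average_coord n (s : fibre n -> K) m :
  cs_coord m (average s) =
  (((4 ^ n)%N%:R : K)^-1) * \sum_(j : fibre n) s j * (@basis_vector R k r r1 a n j m : K).
Proof. exact: (average_map (cs_coord m)). Qed.

(** Flatness against the number of terms: 16 * 2^n / 4^n = 16 / 2^n. *)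
Lemma flat_average n (s : fibre n -> K) (c : K) :
  `|\sum_j s j| <= 16 * 2 ^+ n ->
  rnorm ((((4 ^ n)%N%:R : K)^-1) * \sum_(j : fibre n) s j * c : K^o) <=
    16 / 2 ^+ n * rnorm (c : K^o).
Proof.
move=> h; rewrite -mulr_suml mulrA rnormM ler_wpM2r ?rnorm_ge0//.
rewrite rnormM rnorm_natV mulrC.
have {}h : rnorm (\sum_j s j : K^o) <= (16 * 2 ^ n)%N%:R.
  by apply: rnorm_le_nat; rewrite natrM natrX.
apply: le_trans (ler_wpM2r _ h) _; first by rewrite invr_ge0.
rewrite natrM -mulrA ler_wpM2l// !natrX.
have -> : 4 = 2 * 2 :> R by rewrite -natrM.
by rewrite exprMn invfM mulrA mulfV ?mul1r// expf_neq0.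
Qed.

(** Weighting the vectors of a block by their signs at [g] adds up the coordinate at [g] coherently,
    while flatness makes all other coordinates small. *)
Definition downvec n (g : base n) : X := average (fun j => downsign j g).
Definition upvec n (g : base n.+1) : X := average (fun j => upsign j g).

Lemma upvec_down n (g : base n.+1) (h : base n) :
  rnorm (cs_coord (node h) (upvec g)) <= 16 / 2 ^+ n * a ^+ n.
Proof.
rewrite average_coord; under eq_bigr do rewrite basis_vector_down mulrCA mulrC.
apply: le_trans (flat_average _ _) _; last first.
  by rewrite rnorm_sofR ?exprn_ge0 ?(ltW a_gt0).
under eq_bigr do rewrite mulrC.
exact: downsign_upsign_flat.
Qed.

Lemma downvec_up n (g : base n) (h : base n.+1) :
  rnorm (cs_coord (node h) (downvec g)) <= 16 / 2 ^+ n * a ^+ n.+1.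
Proof.
rewrite average_coord; under eq_bigr do rewrite basis_vector_up mulrCA mulrC.
apply: le_trans (flat_average _ _) _; last first.
  by rewrite rnorm_sofR ?exprn_ge0 ?(ltW a_gt0).
exact: downsign_upsign_flat.
Qed.

Lemma downvec_down n (g h : base n) : g != h ->
  rnorm (cs_coord (node h) (downvec g)) <= 16 / 2 ^+ n * a ^+ n.
Proof.
move=> gh; rewrite average_coord.
under eq_bigr do rewrite basis_vector_down mulrCA mulrC.
apply: le_trans (flat_average _ _) _; last first.
  by rewrite rnorm_sofR ?exprn_ge0 ?(ltW a_gt0).
exact: downsign_flat.
Qed.

Lemma upvec_up n (g h : base n.+1) : g != h ->
  rnorm (cs_coord (node h) (upvec g)) <= 16 / 2 ^+ n * a ^+ n.+1.
Proof.
move=> gh; rewrite average_coord.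
under eq_bigr do rewrite basis_vector_up mulrCA mulrC.
apply: le_trans (flat_average _ _) _; last first.
  by rewrite rnorm_sofR ?exprn_ge0 ?(ltW a_gt0).
exact: upsign_flat.
Qed.

Let fibre_avg n (c : K) : (((4 ^ n)%N%:R : K)^-1) * \sum_(j : fibre n) c = c.
Proof.
rewrite sumr_const card_fibre -[c *+ _]mulr_natl mulrA mulVf ?mul1r//.
Qed.

Lemma downvec_diag n (g : base n) : cs_coord (node g) (downvec g) = sofR k (a ^+ n).
Proof.
rewrite average_coord; under eq_bigr do rewrite basis_vector_down mulrCA downsign_sq mulr1.
exact: fibre_avg.
Qed.

Lemma upvec_diag n (g : base n.+1) : cs_coord (node g) (upvec g) = sofR k (a ^+ n.+1).
Proof.
rewrite average_coord; under eq_bigr do rewrite basis_vector_up mulrCA upsign_sq mulr1.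
exact: fibre_avg.
Qed.

Lemma average_out n (s : fibre n -> K) m :
  level m != Some n -> level m != Some n.+1 -> cs_coord m (average s) = 0.
Proof.
move=> m1 m2; rewrite average_coord big1 ?mulr0// => j _.
by rewrite basis_vector_out ?mulr0.
Qed.

(** At [g] both vectors have the coordinate a^(n+1), which cancels. Elsewhere, in units of a^n /
    2^n, the flat bounds are 16 on level n, 8 + 16 on level n+1 and 8 on level n+2, all below 32. *)
Lemma step_small n (g : base n.+1) :
  rnorm (downvec g - upvec g) <= 42 * (4 `^ r^-1) ^+ n * (32 / 2 ^+ n * a ^+ n).
Proof.
have an0 : 0 <= a ^+ n by rewrite exprn_ge0 ?ltW.
have h0 : 0 <= 2^-1 ^+ n :> R by rewrite exprn_ge0 ?invr_ge0.
rewrite cs_rnormE; apply: rnorm_three_levels.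
- by rewrite -exprVn !mulr_ge0.
- move=> m mj; rewrite -[LHS]/(cs_coord m _) linearB/= !average_out ?subr0//;
    by rewrite mj.
- move=> l h nl; rewrite -[LHS]/(cs_coord _ _) linearB/= !average_out ?subr0//;
    by rewrite level_node; apply: contraNneq nl => -[->];
      rewrite ?leqnn ?leqnSn ?leqW ?leqnn.
move=> l h nl; rewrite -[X in rnorm X]/(cs_coord _ _) linearB/=.
have Dn : 16 / 2 ^+ n.+1 = 8 * 2^-1 ^+ n :> R.
  by rewrite exprS invfM exprVn mulrA; congr (_ * _); lra.
have A1 : a ^+ n.+1 <= a ^+ n by rewrite exprS ler_piMl.
have A2 : a ^+ n.+2 <= a ^+ n by apply: le_trans A1; rewrite exprS ler_piMl// exprn_ge0 ?ltW.
have S (u v c : R) : 0 <= v <= u -> 0 <= c -> c * v <= c * u.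
  by move=> /andP[v0 vu] c0; rewrite ler_wpM2l.
have [e|ln] := eqVneq l n.
  subst l; rewrite average_out ?sub0r ?rnormN; first last.
  - by rewrite level_node; apply/eqP => -[] /eqP; rewrite ltn_eqF.
  - by rewrite level_node; apply/eqP => -[] /eqP; rewrite ltn_eqF.
  apply: le_trans (upvec_down _ _) _; rewrite ler_wpM2r// -exprVn ler_wpM2r//.
  lra.
have [e|ln1] := eqVneq l n.+1.
  subst l; have [<-|gh] := eqVneq g h.
    by rewrite downvec_diag upvec_diag subrr rnorm0 -exprVn !mulr_ge0.
  apply: le_trans (rnormD _ _) _; rewrite rnormN.
  apply: le_trans (lerD (downvec_down gh) (upvec_up gh)) _.
  rewrite -mulrDl Dn -exprVn.
  apply: (@le_trans _ _ ((8 * 2^-1 ^+ n + 16 * 2^-1 ^+ n) * a ^+ n)).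
    by apply: S; [rewrite A1 exprn_ge0 ?(ltW a_gt0) | rewrite addr_ge0 ?mulr_ge0].
  by rewrite ler_wpM2r// -mulrDl ler_wpM2r//; lra.
have el : l = n.+2.
  move: nl => /andP[]; rewrite leq_eqVlt eq_sym (negbTE ln)/= => n1.
  rewrite leq_eqVlt => /predU1P[//|]; rewrite ltnS => n2.
  by case/negP: ln1; rewrite eqn_leq n1 n2.
subst l; rewrite [cs_coord _ (upvec g)]average_out ?subr0; first last.
- by rewrite level_node; apply/eqP => -[] /eqP; rewrite gtn_eqF.
- by rewrite level_node; apply/eqP => -[] /eqP; rewrite gtn_eqF.
apply: le_trans (downvec_up _ _) _; rewrite Dn -exprVn.
apply: (@le_trans _ _ (8 * 2^-1 ^+ n * a ^+ n)).
  by apply: S; [rewrite A2 exprn_ge0 ?(ltW a_gt0) | rewrite mulr_ge0].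
by rewrite ler_wpM2r// ler_wpM2r//; lra.
Qed.

(* The normalized trace of T on the n-th block of basis vectors, see beta_alpha. *)
Definition beta (T : X -> Y) (n : nat) : K^o :=
  (#|{: base n}|%:R : K)^-1 * (sofR k (b ^+ n))^-1 *
    \sum_(g : base n) (cs_coord (node g) (T (downvec g)) : K).

Lemma betaB (T S : X -> Y) n : beta (T \- S) n = beta T n - beta S n.
Proof.
rewrite /beta; under eq_bigr do rewrite /= linearB.
by rewrite sumrB mulrBr.
Qed.

(** Exchanging the sums over [g] and [j] exhibits [beta] as the mean of the diagonal coefficients of
    [T] on the block. *)
Lemma beta_alpha (T : {linear X -> Y}) n :
  beta T n = (((4 ^ n)%N%:R : K)^-1) *
    \sum_(j : fibre n) (alpha b j (cs_val (T (davie_vector a j))) : K).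
Proof.
rewrite /beta /alpha.
have E g : cs_coord (node g) (T (downvec g)) = (((4 ^ n)%N%:R : K)^-1) *
    \sum_(j : fibre n) downsign j g * (cs_coord (node g) (T (davie_vector a j)) : K).
  exact: (average_map (cs_coord (node g) \o T)).
under eq_bigr do rewrite E.
rewrite -!mulr_sumr exchange_big/= mulrCA; congr (_ * _).
Qed.

(** [T] has values in [Y], where [alpha] and [alpha'] coincide; so the same trace can be read on
    level n+1. *)
Lemma beta_up (T : {linear X -> Y}) n :
  beta T n = (#|{: base n.+1}|%:R : K)^-1 * (sofR k (b ^+ n.+1))^-1 *
    \sum_(g : base n.+1) (cs_coord (node g) (T (upvec g)) : K).
Proof.
rewrite beta_alpha; under eq_bigr do rewrite alphaE ?cs_valP//.
have E g : cs_coord (node g) (T (upvec g)) = (((4 ^ n)%N%:R : K)^-1) *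
    \sum_(j : fibre n) upsign j g * (cs_coord (node g) (T (davie_vector a j)) : K).
  exact: (average_map (cs_coord (node g) \o T)).
under [in RHS]eq_bigr do rewrite E.
rewrite -!mulr_sumr exchange_big/= [RHS]mulrCA; congr (_ * _).
Qed.

Let rnorm_sofRV n : rnorm ((sofR k (b ^+ n))^-1 : K^o) = (b ^+ n)^-1.
Proof.
by rewrite -sofRV ?gt_eqF ?exprn_gt0// rnorm_sofR// invr_ge0 exprn_ge0// ltW.
Qed.

Let coord_avg_le n (T : X -> Y) (u : base n -> X) (M D : R) :
  0 <= M -> (forall x, rnorm (T x) <= M * rnorm x) -> (forall g, rnorm (u g) <= D) ->
  rnorm ((#|{: base n}|%:R : K)^-1 * (sofR k (b ^+ n))^-1 *
    \sum_(g : base n) (cs_coord (node g) (T (u g)) : K) : K^o) <= (b ^+ n)^-1 * (M * D).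
Proof.
move=> M0 hT hu; rewrite mulrAC mulrC rnormM rnorm_sofRV.
rewrite ler_wpM2l ?invr_ge0 ?exprn_ge0 ?(ltW b_gt0)//.
apply: rnorm_avg_le => // [|g]; first by rewrite card_base muln_gt0 expn_gt0.
apply: le_trans (cs_coord_le _ _) _; apply: le_trans (hT _) _.
by rewrite ler_wpM2l.
Qed.

(** Both traces are read on level n+1, so their difference is an average of coordinates of [T] at
    the vectors of [step_small]; 1344 = 42 * 32. *)
Lemma beta_step (T : {linear X -> Y}) (M : R) n : 0 <= M ->
  (forall x, rnorm (T x) <= M * rnorm x) ->
  rnorm (beta T n.+1 - beta T n) <=
    1344 / b * (4 `^ r^-1 * a / (2 * b)) ^+ n * M.
Proof.
move=> M0 hT; rewrite (beta_up T n) /beta -mulrBr -sumrB.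
under eq_bigr do rewrite -!linearB.
apply: le_trans (coord_avg_le M0 hT (@step_small n)) _.
rewrite le_eqVlt; apply/orP; left; apply/eqP.
rewrite !exprMn exprVn exprMn invfM exprS invfM.
have -> : 1344 = 42 * 32 :> R by rewrite -natrM.
by rewrite -!mulrA; ring.
Qed.

Hypothesis ratio : 4 `^ r^-1 * a < 2 * b.

(** By [ratio] the steps decay geometrically; their sum is added to a crude bound for block 0. *)
Lemma beta_bounded : exists2 C : R, 0 <= C & forall (T : {linear X -> Y}) (M : R),
  0 <= M -> (forall x, rnorm (T x) <= M * rnorm x) ->
  forall n, rnorm (beta T n) <= C * M.
Proof.
pose th := 4 `^ r^-1 * a / (2 * b).
have th0 : 0 <= th by rewrite divr_ge0 ?mulr_ge0 ?powR_ge0 ?(ltW a_gt0) ?(ltW b_gt0).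
have th1 : th < 1 by rewrite ltr_pdivrMr ?mul1r// mulr_gt0.
pose D0 := \sum_(g : base 0) rnorm (downvec g).
have D00 : 0 <= D0 by apply: sumr_ge0 => g _; exact: rnorm_ge0.
pose D1 := 1344 / b.
have D10 : 0 <= D1 by rewrite divr_ge0 ?ler0n ?(ltW b_gt0).
exists (D0 + D1 / (1 - th)).
  by rewrite addr_ge0// divr_ge0// subr_ge0 ltW.
move=> T M M0 hT n.
have H0 : rnorm (beta T 0) <= D0 * M.
  rewrite mulrC; apply: le_trans (coord_avg_le (D := D0) M0 hT _) _.
    by move=> g; rewrite /D0 (bigD1 g)//= lerDl sumr_ge0// => h _; exact: rnorm_ge0.
  by rewrite expr0 invr1 mul1r.
have H : rnorm (beta T n) <= (D0 + D1 * \sum_(0 <= i < n) th ^+ i) * M.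
  elim: n => [|n IH]; first by rewrite big_geq// mulr0 addr0.
  have -> : beta T n.+1 = beta T n + (beta T n.+1 - beta T n) by rewrite addrC subrK.
  apply: le_trans (rnormD _ _) _; rewrite big_nat_recr//= mulrDr addrA mulrDl.
  by rewrite lerD// beta_step.
apply: le_trans H _; rewrite ler_wpM2r// lerD2l ler_wpM2l//.
by apply: geometric_le; rewrite th0.
Qed.

(** The quantity is [beta] of the operator sending x to [l x *: y]. It vanishes for large n when y
    is a basis vector, and it is bounded by a multiple of the norm of y uniformly in n, so it tends
    to 0 on the closed span. *)
Lemma rank_one_limit (l : X -> K^o) (M : R) (y : Y) : 0 <= M ->
  (forall (c : K) u v, l (c *: u + v) = c *: l u + l v) ->
  (forall x, rnorm (l x) <= M * rnorm x) ->
  forall e : R, 0 < e -> exists n0, forall n, (n0 <= n)%N ->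
  rnorm ((((4 ^ n)%N%:R : K)^-1) * \sum_(j : fibre n)
    (l (davie_vector a j) : K) * (alpha b j (cs_val y) : K) : K^o) <= e.
Proof.
move=> M0 llin lbd.
pose gamma n (z : ell k q1) : K^o := (((4 ^ n)%N%:R : K)^-1) * \sum_(j : fibre n)
    (l (davie_vector a j) : K) * (alpha b j z : K).
have gammaP n (c : K) u v : gamma n (c *: u + v) = c *: gamma n u + gamma n v.
  rewrite /gamma; under eq_bigr do rewrite linearP/= mulrDr mulrCA.
  by rewrite big_split/= -mulr_sumr mulrDr mulrCA.
have [C C0 hC] := beta_bounded.
have gamma_le n (z : Y) : rnorm (gamma n (cs_val z)) <= C * M * rnorm z.
  pose T0 (x : X) : Y := (l x : K) *: z.
  have T0lin : linear T0.
    by move=> c u v; rewrite /T0 llin scalerDl scalerA.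
  pose T : {linear X -> Y} := HB.pack T0 (GRing.isLinear.Build K X Y *:%R T0 T0lin).
  have hT x : rnorm (T x) <= M * rnorm z * rnorm x.
    by rewrite -[T x]/(T0 x) rnormZ mulrAC ler_wpM2r ?rnorm_ge0.
  rewrite -mulrA; apply: le_trans (hC T _ _ hT n); last by rewrite mulr_ge0 ?rnorm_ge0.
  rewrite beta_alpha le_eqVlt; apply/orP; left; apply/eqP; congr (rnorm (_ * _ : K^o)).
  apply: eq_bigr => j _.
  transitivity (alpha b j ((l (davie_vector a j) : K) *: cs_val z)); last by [].
  by rewrite linearZ.
have gammaD n u v : gamma n (u + v) = gamma n u + gamma n v.
  by rewrite -[u]scale1r gammaP !scale1r.
(* Membership in [Y] is carried along because the bound uniform in n is available only there. *)
pose A := [set z : ell k q1 | z \in cs_pred Y /\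
  forall e : R, 0 < e -> exists n0, forall n, (n0 <= n)%N -> rnorm (gamma n z) <= e].
suff [] : A (cs_val y) by [].
have dY z : z \in cs_pred Y -> forall n, rnorm (gamma n z) <= C * M * rnorm z.
  by move=> zY n; have := gamma_le n (CsElt zY).
have [Y0 YP] := cs_submod Y.
apply: (cspan_ind (cs_valP y)).
- apply: closed_rnorm => z hz.
  have zY : z \in cs_pred Y.
    apply: (closed_rnormP (cs_closed (c := Y))) => e /hz[w [wY _] zw].
    by exists w.
  split => // e e0; have e20 : 0 < e / 2 by rewrite divr_gt0.
  have CM : 0 < C * M + 1 by rewrite ltr_wpDl ?mulr_ge0.
  have [w [wY /(_ _ e20)[n0 hw]] zw] := hz _ (divr_gt0 e20 CM).
  exists n0 => n nn0.
  have -> : gamma n z = gamma n (z - w) + gamma n w by rewrite -gammaD subrK.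
  apply: le_trans (rnormD _ _) _; rewrite (splitr e) lerD ?hw//.
  have zwY : z - w \in cs_pred Y.
    by rewrite addrC -scaleN1r; exact: YP.
  apply: le_trans (dY _ zwY n) _; apply: le_trans (_ : (C * M + 1) * rnorm (z - w) <= _).
    by rewrite ler_wpM2r ?rnorm_ge0// lerDl.
  by rewrite mulrC -ler_pdivlMr// ltW.
- split => // e e0; exists 0%N => n _.
  by rewrite (le_trans (dY _ Y0 n))// rnorm0 mulr0 ltW.
- move=> c u v [uY hu] [vY hv]; split; first exact: YP.
  move=> e e0; have e20 : 0 < e / 2 by rewrite divr_gt0.
  have c1 : 0 < rnorm (c : K^o) + 1 by rewrite ltr_wpDl ?rnorm_ge0.
  have [n1 h1] := hu _ (divr_gt0 e20 c1); have [n2 h2] := hv _ e20.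
  exists (maxn n1 n2) => n; rewrite geq_max => /andP[nn1 nn2].
  rewrite gammaP; apply: le_trans (rnormD _ _) _; rewrite (splitr e) lerD ?h2//.
  rewrite rnormZ; apply: le_trans (_ : (rnorm (c : K^o) + 1) * rnorm (gamma n u) <= _).
    by rewrite ler_wpM2r ?rnorm_ge0// lerDl.
  by rewrite mulrC -ler_pdivlMr// h1.
- case=> m j; split; first exact: cs_valP (davie_vector b j).
  move=> e e0; exists m.+1 => n mn; rewrite /gamma big1 ?mulr0 ?rnorm0 ?ltW// => i _.
  by rewrite alpha_basis_neq ?mulr0// gtn_eqF.
Qed.

Lemma beta_identity (U : {linear X -> Y}) n :
  (forall n (j : fibre n), cs_val (U (davie_vector a j)) = basis_vector b j) ->
  beta U n = 1.
Proof.
move=> hU; rewrite beta_alpha; under eq_bigr do rewrite hU alpha_basis// eqxx.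
exact: fibre_avg.
Qed.

Lemma inclusion_not_approximable (U : {linear X -> Y}) : bounded_op X Y U ->
  (forall n (j : fibre n), cs_val (U (davie_vector a j)) = basis_vector b j) ->
  ~ approximable X Y U.
Proof.
move=> /bounded_opP[D D0 hD] hU [_ happ].
have [C C0 hC] := beta_bounded.
have C1 : 0 < 2 * (C + 1) by rewrite mulr_gt0// ltr_wpDl.
have [S [Sb [N [c hc]]] US] := happ (2 * (C + 1))^-1 (etrans (invr_gt0 _) C1).
have [E E0 hE] := (bounded_opP S).1 Sb.
have [|m [l [v [M [M0 llin lbd Sl]]]]] := @finite_rank_coords _ _ _ _ _ _ N S c E E0 _ hE hc.
  by move=> d x y; rewrite linearP.
have hUS x : rnorm ((U \- S) x) <= opnorm (U \- S) * rnorm x.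
  apply: (@le_opnorm _ _ _ _ _ (D + E)); first by rewrite addr_ge0.
    by move=> d z; rewrite linearZ.
  by move=> z; apply: le_trans (rnormD _ _) _; rewrite rnormN mulrDl lerD.
have H1 n : rnorm (beta (U \- S) n) <= 2^-1.
  apply: le_trans (hC _ _ (opnorm_ge0 _) hUS n) _.
  apply: le_trans (_ : C * (2 * (C + 1))^-1 <= _); first by rewrite ler_wpM2l// ltW.
  by rewrite ler_pdivrMr// mulrA mulVf// mul1r lerDl.
have H2 n : beta (U \- S) n = 1 - beta S n.
  by rewrite betaB (beta_identity n hU).
have H3 n : beta S n = \sum_(i < m) (((4 ^ n)%N%:R : K)^-1) * \sum_(j : fibre n)
    (l i (davie_vector a j) : K) * (alpha b j (cs_val (v i)) : K).
  rewrite beta_alpha -[RHS]mulr_sumr [X in _ = _ * X]exchange_big/=.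
  congr (_ * _); apply: eq_bigr => j _.
  rewrite Sl.
  have -> : cs_val (\sum_(i < m) (l i (davie_vector a j) : K) *: v i) =
      \sum_(i < m) (l i (davie_vector a j) : K) *: cs_val (v i).
    by elim/big_ind2 : _ => // x1 x2 y1 y2 <- <-.
  by rewrite linear_sum; apply: eq_bigr => i _; rewrite linearZ.
(* With m rank-one parts of this size, [beta S n] is at most 1/4, while [beta (U \- S) n] is at most
   1/2 and the two add up to 1. *)
have e0 : 0 < (4 * m.+1%:R)^-1 :> R by rewrite invr_gt0 mulr_gt0.
have H4 i := @rank_one_limit (l i) M (v i) M0 (llin i) (lbd i) _ e0.
have [f hf] := choice H4.
pose n := (\max_(i < m) f i)%N.
have H5 : rnorm (beta S n) <= 4^-1.
  rewrite H3; apply: le_trans (rnorm_sum _ _ _) _.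
  apply: le_trans (ler_sum _ (fun i _ => hf i n (leq_bigmax i))) _.
  rewrite sumr_const card_ord -[_ *+ m]mulr_natl invfM mulrCA ger_pMr ?invr_gt0//.
  by rewrite ler_pdivrMr// mul1r ler_nat.
have := H1 n; rewrite H2 => H6.
have : rnorm (1 : K^o) <= 2^-1 + 4^-1 :> R.
  rewrite -[1 : K^o](subrK (beta S n)).
  by apply: le_trans (rnormD _ _) _; rewrite lerD.
rewrite (rnorm_unit (normr1 _)).
lra.
Qed.

End Trace.

(** * Weighted inclusions *)

Section WeightedEmbedding.
Context {R : realType}.
Variables p q : R.
Hypotheses (p_gt0 : 0 < p) (q_gt0 : 0 < q).
Local Notation s := (Num.min p q).

Let one_powR (x : R) : 1 `^ x = 1. Proof. by rewrite powR1. Qed.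

(** If p < q, then s = p and w t <= 1, so the q-th power of w t is below its p-th power. Otherwise s
    = q, and t^q <= 1 + t^p. *)
Lemma powR_young (w t : R) : 0 <= w -> 0 <= t -> w `^ s * t `^ p <= 1 ->
  (w * t) `^ q <= w `^ s + w `^ s * t `^ p.
Proof.
move=> w0 t0; rewrite /Num.min; case: ltP => [pq|qp] h.
- rewrite -powRM// in h *.
  apply: (@le_trans _ _ ((w * t) `^ p)); last by rewrite lerDr powR_ge0.
  have [->|wt0] := eqVneq (w * t) 0; first by rewrite !powR0 ?gt_eqF.
  have wt1 : w * t <= 1.
    rewrite leNgt; apply/negP => wt; move: h; apply/negP; rewrite -ltNge.
    by rewrite -[X in X < _](one_powR p) gt0_ltr_powR ?nnegrE ?mulr_ge0.
  by rewrite ger_powR ?(ltW pq)// wt1 andbT lt_neqAle eq_sym wt0 mulr_ge0.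
- rewrite powRM// -[X in _ <= X + _]mulr1 -mulrDr ler_wpM2l ?powR_ge0//.
  have [t1|t1] := leP t 1.
    apply: (@le_trans _ _ 1); last by rewrite lerDl powR_ge0.
    by rewrite -[leRHS](one_powR q) ge0_ler_powR ?nnegrE ?(ltW q_gt0).
  by apply: (@le_trans _ _ (t `^ p)); [rewrite ler_powR ?(ltW t1)|rewrite lerDr].
Qed.

(** Rescaling f to t = C f / E turns the hypothesis into a bound 1 for the sum of w^s t^p. Summing
    [powR_young] then bounds the sum of (w t)^q by S + 1 = C^q. *)
Lemma weighted_embedding (w f : nat -> R) (S E : R) :
  (forall m, 0 <= w m) -> (forall m, 0 <= f m) -> 0 <= E -> 0 <= S ->
  (forall N, \sum_(0 <= m < N) w m `^ s <= S) ->
  (forall N, \sum_(0 <= m < N) ((S + 1) `^ q^-1 * (w m `^ (s / p)) * f m) `^ p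
     <= E `^ p) ->
  forall N, \sum_(0 <= m < N) (w m * f m) `^ q <= E `^ q.
Proof.
move=> w0 f0 E0 S0 hS hE N; set C := (S + 1) `^ q^-1.
have S1 : 0 < S + 1 by rewrite ltr_wpDl.
have C0 : 0 < C by rewrite powR_gt0.
have hm m : (C * (w m `^ (s / p)) * f m) `^ p <= E `^ p.
  apply: le_trans (hE m.+1); rewrite big_nat_recr//= lerDr sumr_ge0// => i _.
  exact: powR_ge0.
have wsp m : (w m `^ (s / p)) `^ p = w m `^ s.
  by rewrite -powRrM divfK// gt_eqF.
(* The rescaling divides by [E], so E = 0 is settled first: all products w f vanish. *)
have [E1|E1] := eqVneq E 0.
  rewrite big1 ?powR_ge0// => m _.
  have := hm m; rewrite E1 powR0 ?gt_eqF// => h.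
  have /eqP : (C * (w m `^ (s / p)) * f m) `^ p = 0.
    by apply/eqP; rewrite eq_le h powR_ge0.
  rewrite powR_eq0 !mulf_eq0 (gt_eqF C0)/= => /andP[/orP[wm|/eqP ->] _].
    by move: wm; rewrite powR_eq0 => /andP[/eqP -> _]; rewrite mul0r powR0// gt_eqF.
  by rewrite mulr0 powR0// gt_eqF.
have {}E0 : 0 < E by rewrite lt_neqAle eq_sym E1.
pose t m := C * f m / E.
have t0 m : 0 <= t m by rewrite divr_ge0 ?mulr_ge0// ltW.
have fE m : f m = E / C * t m.
  by rewrite /t; field; rewrite !gt_eqF.
have Ep : 0 < E `^ p by rewrite powR_gt0.
have term m : (C * (w m `^ (s / p)) * f m) `^ p = E `^ p * (w m `^ s * t m `^ p).
  rewrite -wsp -powRM ?powR_ge0 ?t0//.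
  rewrite -powRM ?(ltW E0) ?mulr_ge0 ?powR_ge0 ?t0 ?invr_ge0 ?(ltW E0)//.
  by congr (_ `^ _); rewrite fE; field; rewrite gt_eqF.
have tot : \sum_(0 <= m < N) w m `^ s * t m `^ p <= 1.
  rewrite -(ler_pM2l Ep) mulr1 mulr_sumr.
  by apply: le_trans (hE N); apply: ler_sum => i _; rewrite term.
have tm m : w m `^ s * t m `^ p <= 1.
  by rewrite -(ler_pM2l Ep) mulr1 -term; exact: hm.
have -> : \sum_(0 <= m < N) (w m * f m) `^ q =
    (E / C) `^ q * \sum_(0 <= m < N) (w m * t m) `^ q.
  rewrite mulr_sumr; apply: eq_bigr => m _.
  rewrite -powRM ?mulr_ge0 ?invr_ge0 ?t0 ?w0 ?(ltW E0) ?(ltW C0)//.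
  by congr (_ `^ _); rewrite fE mulrCA.
have CQ : C `^ q = S + 1.
  by rewrite /C -powRrM mulVf ?gt_eqF// powRr1// ltW.
have EC : E `^ q = (E / C) `^ q * (S + 1).
  rewrite -CQ -powRM ?divr_ge0 ?(ltW E0) ?(ltW C0)//.
  by rewrite divfK// gt_eqF.
rewrite EC ler_wpM2l ?powR_ge0//.
apply: le_trans (ler_sum _ (fun m _ => powR_young (w0 m) (t0 m) (tm m))) _.
by rewrite big_split/= lerD.
Qed.

End WeightedEmbedding.

Section Inclusion.
Context {R : realType} {k : scalar_kind}.
Local Notation K := (scalars R k).
Variables p q : R.
Hypotheses (p1 : 1 <= p) (q1 : 1 <= q).
Local Notation s := (Num.min p q).
Variables a b : R.
Hypotheses (a_gt0 : 0 < a) (b_gt0 : 0 < b) (b_small : 4 * b `^ s < 1).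

Let p_gt0 : 0 < p. Proof. exact: lt_le_trans p1. Qed.
Let q_gt0 : 0 < q. Proof. exact: lt_le_trans q1. Qed.
Let s_gt0 : 0 < s. Proof. by rewrite lt_min p_gt0. Qed.

Definition mass : R := 2 / (1 - 4 * b `^ s).
Definition embedding_cst : R := (mass + 1) `^ q^-1.

Lemma mass_ge0 : 0 <= mass.
Proof. by rewrite divr_ge0// subr_ge0 ltW. Qed.

Lemma embedding_cst_gt0 : 0 < embedding_cst.
Proof. by rewrite powR_gt0// ltr_wpDl ?mass_ge0. Qed.

Lemma sum_weight_min N : \sum_(0 <= m < N) weight b m `^ s <= mass.
Proof.
under eq_bigr do rewrite -weight_powR ?(ltW b_gt0)//.
by apply: sum_weight_le; rewrite ?powR_ge0.
Qed.

Lemma weight_div (t u : R) m : 0 < u -> weight (t / u) m = weight t m / weight u m.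
Proof.
by move=> u0; rewrite /weight; case: level => [n|]; rewrite ?expr_div_n ?mul0r.
Qed.

(** This is [weighted_embedding] for the sequence |x_m| / a_m; at integers encoding no point all
    weights are 0, and so are both sides. *)
Lemma lnorm_embedding (x : nat -> K^o) (E : R) : 0 <= E ->
  (lnorm p (fun m => sofR k (embedding_cst * weight (b `^ (s / p) / a) m) *: x m)
     <= E%:E)%E ->
  (lnorm q (fun m => sofR k (weight (b / a) m) *: x m) <= E%:E)%E.
Proof.
move=> E0 /(lnorm_leP p1 _ E0) h; apply/(lnorm_leP q1 _ E0).
pose f m := rnorm (x m) / weight a m.
have C0 := ltW embedding_cst_gt0.
have f0 m : 0 <= f m by rewrite divr_ge0 ?rnorm_ge0 ?weight_ge0 ?ltW.
have w0 m : 0 <= weight b m by rewrite weight_ge0 ?ltW.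
have := @weighted_embedding R p q p_gt0 q_gt0 (weight b) f mass E w0 f0 E0 mass_ge0
  sum_weight_min.
have H1 m : embedding_cst * weight b m `^ (s / p) * f m =
    rnorm (sofR k (embedding_cst * weight (b `^ (s / p) / a) m) *: x m : K^o).
  rewrite rnormZ rnorm_sofR ?mulr_ge0 ?weight_ge0 ?divr_ge0 ?powR_ge0 ?(ltW a_gt0)//.
  by rewrite weight_div// weight_powR ?divr_gt0 ?(ltW b_gt0)// /f; ring.
have H2 m : weight b m * f m = rnorm (sofR k (weight (b / a) m) *: x m : K^o).
  rewrite rnormZ rnorm_sofR ?weight_ge0 ?divr_ge0 ?(ltW a_gt0) ?(ltW b_gt0)//.
  by rewrite weight_div// /f; ring.
move=> H N; have := H _ N; under eq_bigr do rewrite H2.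
apply => M; under eq_bigr do rewrite -/embedding_cst H1.
exact: h.
Qed.

Context {r : R} {r1 : 1 <= r}.
Local Notation X := (@davie R k r r1 a).
Local Notation Y := (@davie R k q q1 b).

(** Multiplication by (b/a)^n on level n carries the basis vectors of [X] to those of [Y], hence by
    continuity [X] into [Y]. The bound is assumed so that both choices of source are covered. *)
Lemma inclusion_exists (D : R) : 0 <= D ->
  (forall x : ell k r1,
    (lnorm q (fun m => sofR k (weight (b / a) m) *: x m) <= (D * rnorm x)%:E)%E) ->
  exists U : {linear X -> Y},
  [/\ bounded_op X Y U,
      forall x m, cs_coord m (U x) = sofR k (weight (b / a) m) * (cs_coord m x : K) &
      forall n (j : fibre n), cs_val (U (davie_vector a j)) = basis_vector b j].
Proof.
move=> D0 hD; pose d m := sofR k (weight (b / a) m).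
have mem (x : ell k r1) : (fun m => d m *: x m : K^o) \in @ell_pred R k q.
  by rewrite inE /=; apply: le_lt_trans (hD x) _; rewrite ltry.
pose diag x : ell k q1 := Ell q1 (mem x).
have diag_lin (c : K) x y : diag (c *: x + y) = c *: diag x + diag y.
  apply: ell_ext => m; rewrite ell_linE.
  transitivity (d m * (c * (x m : K) + y m)); first by rewrite -ell_linE.
  by rewrite mulrDr mulrCA.
have diag_le x : rnorm (diag x) <= D * rnorm x.
  by rewrite -lee_fin ell_rnormE; exact: hD.
have diag_basis n (j : fibre n) : diag (basis_vector a j) = basis_vector b j.
  have ab l : sofR k (weight (b / a) l) * sofR k (weight a l) = sofR k (weight b l).
    rewrite -sofRM -weightM; congr (sofR k (weight _ _)).
    by rewrite divfK// gt_eqF.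
  apply: ell_ext => m; transitivity (d m * ((basis_vector a j : ell k r1) m : K)); first by [].
  have [ln|ln] := eqVneq (level m) (Some n).
    have [g ->] := level_some ln; rewrite !basis_vector_down mulrA.
    by have := ab (node g); rewrite /d !weight_node => ->.
  have [ln1|ln1] := eqVneq (level m) (Some n.+1).
    have [g ->] := level_some ln1; rewrite !basis_vector_up mulrA.
    by have := ab (node g); rewrite /d !weight_node => ->.
  by rewrite !basis_vector_out// mulr0.
have diagB x y : diag (x - y) = diag x - diag y.
  by rewrite addrC -scaleN1r diag_lin scaleN1r addrC.
have diagX (x : X) : diag (cs_val x) \in cs_pred Y.
  have [Y0 YP] := cs_submod Y.
  apply: (cspan_ind (A := [set z | diag z \in cs_pred Y]) (cs_valP x)).
  - apply: closed_rnorm => y hy; apply: (closed_rnormP (cs_closed (c := Y))) => e e0.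
    have D1 : 0 < D + 1 by rewrite ltr_wpDl.
    have [z /= zY yz] := hy _ (divr_gt0 e0 D1); exists (diag z) => //.
    rewrite -diagB; apply: le_lt_trans (diag_le _) _.
    apply: le_lt_trans (_ : (D + 1) * rnorm (y - z) < _).
      by rewrite ler_wpM2r ?rnorm_ge0// lerDl.
    by rewrite mulrC -ltr_pdivlMr.
  - rewrite /= (_ : diag 0 = 0)//; apply: ell_ext => m.
    by rewrite -[LHS]/(d m * (0 : K)) mulr0.
  - by move=> c y z /= hy hz; rewrite diag_lin; exact: YP.
  - by case=> n j; rewrite /= diag_basis; exact: cs_valP (davie_vector b j).
pose U0 (x : X) : Y := CsElt (diagX x).
have U0lin : linear U0.
  by move=> c x y; apply: val_inj; rewrite /= -diag_lin.
pose U : {linear X -> Y} := HB.pack U0 (GRing.isLinear.Build K X Y *:%R U0 U0lin).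
exists U; split.
- by apply/bounded_opP; exists D => // x; rewrite cs_rnormE; exact: diag_le.
- by [].
- by move=> n j; exact: diag_basis.
Qed.

Lemma inclusion_rnorm_le (U : X -> Y) (x : X) (E : R) : 0 <= E ->
  (forall m, cs_coord m (U x) = sofR k (weight (b / a) m) * (cs_coord m x : K)) ->
  (lnorm p (fun m => sofR k (embedding_cst * weight (b `^ (s / p) / a) m) *:
     (cs_coord m x)) <= E%:E)%E ->
  rnorm (U x) <= E.
Proof.
move=> E0 hU /(lnorm_embedding E0); rewrite cs_rnormE -lee_fin ell_rnormE.
congr (lnorm q _ <= _)%E; apply/funext => m; exact/esym/hU.
Qed.

End Inclusion.

(** * Quasi-nuclear and compact inclusions *)

Section QuasiNuclear.
Context {R : realType} {k : scalar_kind}.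
Local Notation K := (scalars R k).
Variables p q : R.
Hypotheses (p1 : 1 <= p) (q1 : 1 <= q).
Local Notation s := (Num.min p q).
Variables a b : R.
Hypotheses (a_gt0 : 0 < a) (b_gt0 : 0 < b) (b_small : 4 * b `^ s < 1).

Let p_gt0 : 0 < p. Proof. exact: lt_le_trans p1. Qed.
Let q_gt0 : 0 < q. Proof. exact: lt_le_trans q1. Qed.
Let s_gt0 : 0 < s. Proof. by rewrite lt_min p_gt0. Qed.

(** For a = 1 the functionals are C b_m^(s/p) times the coordinates. Coordinates have norm at most 1
    in every l^r, and the p-th powers of the factors are summable by [sum_weight_min]. *)
Lemma quasi_nuclear_inclusion (r : R) (r1 : 1 <= r) :
  exists U : {linear @davie R k r r1 1 -> @davie R k q q1 b},
    [/\ quasi_nuclear p _ _ U, bounded_op _ _ U &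
     forall n (j : fibre n), cs_val (U (davie_vector 1 j)) = basis_vector b j].
Proof.
pose C := embedding_cst p q b.
have C0 : 0 < C by exact: embedding_cst_gt0.
have S0 := mass_ge0 b_small.
pose ka m := C * weight (b `^ (s / p) / 1) m.
have ka0 m : 0 <= ka m by rewrite mulr_ge0 ?(ltW C0)// weight_ge0// divr1 powR_ge0.
pose E1 := C * mass p q b `^ p^-1.
have E10 : 0 <= E1 by rewrite mulr_ge0 ?(ltW C0) ?powR_ge0.
have kasum N : \sum_(0 <= m < N) ka m `^ p <= E1 `^ p.
  rewrite powRM ?powR_ge0 ?(ltW C0)// -powRrM mulVf ?gt_eqF// powRr1//.
  rewrite (eq_bigr (fun m => C `^ p * weight b m `^ s)).
    by rewrite -mulr_sumr ler_wpM2l ?powR_ge0// sum_weight_min.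
  move=> m _; rewrite powRM ?(ltW C0) ?weight_ge0 ?divr1 ?powR_ge0//.
  by rewrite weight_powR ?divr_gt0 ?(ltW b_gt0)// -powRrM divfK// gt_eqF.
have kal (x : ell k r1) :
    (lnorm p (fun m => sofR k (ka m) *: x m) <= (E1 * rnorm x)%:E)%E.
  have Ex : 0 <= E1 * rnorm x by rewrite mulr_ge0 ?rnorm_ge0.
  apply/(lnorm_leP p1 _ Ex) => N; rewrite powRM ?rnorm_ge0//.
  apply: le_trans (_ : \sum_(0 <= m < N) ka m `^ p * rnorm x `^ p <= _).
    apply: ler_sum => m _; rewrite rnormZ rnorm_sofR// powRM ?rnorm_ge0//.
    rewrite ler_wpM2l ?powR_ge0// ge0_ler_powR ?nnegrE ?rnorm_ge0 ?(ltW p_gt0)//.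
    exact: ell_coord_le.
  by rewrite -mulr_suml ler_wpM2r ?powR_ge0.
have [|U [Ub Uc Ue]] := @inclusion_exists R k q q1 1 b ltr01 r r1 E1 E10.
  move=> x; apply: (@lnorm_embedding R k p q p1 q1 1 b ltr01 b_gt0 b_small).
    by rewrite mulr_ge0 ?rnorm_ge0.
  exact: kal.
exists U; split => //; split => //.
exists (fun m => (sofR k (ka m) \*: cs_coord m : {linear _ -> K^o})).
have fle m (x : @davie R k r r1 1) : rnorm (sofR k (ka m) *: cs_coord m x : K^o) <= ka m * rnorm x.
  by rewrite rnormZ rnorm_sofR// ler_wpM2l// cs_coord_le.
split.
- by move=> m; apply/bounded_opP; exists (ka m) => // x; exact: fle.
- apply: (@le_lt_trans _ _ (E1 `^ p)%:E); last by rewrite ltry.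
  apply: lime_le.
    by apply: is_cvg_nneseries => n _ _; rewrite lee_fin powR_ge0.
  apply: nearW => N; rewrite sumEFin lee_fin; apply: le_trans (kasum N).
  apply: ler_sum => m _; apply: ge0_ler_powR; rewrite ?nnegrE ?opnorm_ge0 ?(ltW p_gt0)//.
  by apply: opnorm_le => // x; exact: fle.
- move=> x.
  suff : ((rnorm (U x))%:E <= lnorm p (fun m => sofR k (ka m) *: cs_coord m x))%E.
    by rewrite lnormE.
  have := @lnorm_ge0 R k p (fun m => sofR k (ka m) *: cs_coord m x).
  case E : (lnorm p _) => [e| |]; rewrite ?leey//.
  rewrite !lee_fin => e0.
  apply: (inclusion_rnorm_le p1 ltr01 b_gt0 b_small e0 (Uc x)).
  by rewrite -/C E.
Qed.

(** Only finitely many integers encode points on the levels below a given one. *)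
Lemma weight_small (t e : R) : 0 <= t < 1 -> 0 < e ->
  exists N, forall m, (N <= m)%N -> weight t m <= e.
Proof.
move=> /andP[t0 t1] e0.
have [L tL] : exists L, t ^+ L <= e.
  have /cvgrPdist_le/(_ _ e0)[L _ hL] := @cvg_expr R t (ltac:(by rewrite ger0_norm)).
  exists L; have := hL L (leqnn L).
  by rewrite /= sub0r normrN ger0_norm ?exprn_ge0.
exists (\max_(l < L) \max_(g : base l) (node g).+1)%N => m Nm; rewrite /weight.
case E : (level m) => [l|]; last exact: ltW.
apply: le_trans tL; have [Ll|lL] := leqP L l.
  by apply: ler_wiXn2l => //; exact: ltW.
have [g mg] := level_some E; move: Nm.
rewrite leqNgt => /negP[]; rewrite {1}mg.
apply: leq_trans (@leq_bigmax _ (fun g : base l => (node g).+1) g) _.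
exact: (@leq_bigmax _ (fun l : 'I_L => \max_(g : base l) (node g).+1)%N (Ordinal lL)).
Qed.

Hypothesis ab : b `^ (s / p) < a.

(** By [ab] the weights of the majorant tend to 0, so U x is approximated by its first N coordinates
    uniformly on the unit ball. *)
Lemma compact_inclusion :
  exists U : {linear @davie R k p p1 a -> @davie R k q q1 b},
    [/\ compact_op _ _ U, bounded_op _ _ U &
     forall n (j : fibre n), cs_val (U (davie_vector a j)) = basis_vector b j].
Proof.
pose C := embedding_cst p q b.
have C0 : 0 < C by exact: embedding_cst_gt0.
pose nu := b `^ (s / p) / a.
have nu0 : 0 <= nu by rewrite divr_ge0 ?powR_ge0 ?ltW.
have nu1 : nu < 1 by rewrite ltr_pdivrMr ?mul1r.
have w0 m : 0 <= weight nu m by exact: weight_ge0.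
have kal (x : nat -> K^o) (c e : R) : 0 <= c -> 0 <= e ->
    (lnorm p x <= e%:E)%E -> (forall m, x m = 0 \/ C * weight nu m <= c) ->
    (lnorm p (fun m => sofR k (C * weight nu m) *: x m) <= (c * e)%:E)%E.
  move=> c0 e0 xe hc; have ce : 0 <= c * e by rewrite mulr_ge0.
  apply: (@le_trans _ _ (lnorm p (fun m => sofR k c *: x m))).
    apply: le_lnorm => // m; rewrite !rnormZ !rnorm_sofR// ?mulr_ge0 ?(ltW C0)//.
    by have [->|] := hc m; rewrite ?rnorm0 ?mulr0// => h; rewrite ler_wpM2r ?rnorm_ge0.
  apply: le_trans (lnormZ_le p1 _ _) _; rewrite rnorm_sofR// EFinM.
  by rewrite lee_wpmul2l// lee_fin.
have [|U [Ub Uc Ue]] := @inclusion_exists R k q q1 a b a_gt0 p p1 C (ltW C0).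
  move=> x; apply: (@lnorm_embedding R k p q p1 q1 a b a_gt0 b_gt0 b_small).
    by rewrite mulr_ge0 ?rnorm_ge0 ?ltW.
  apply: kal; [exact: ltW|exact: rnorm_ge0|by rewrite ell_rnormE|move=> m; right].
  by rewrite ger_pMr// weight_le1// nu0 ltW.
exists U; split => //; split => //.
have [D D0 hD] := (bounded_opP U).1 Ub.
apply: precompact_ultra => F FU FB e e0.
(* Convergence is tested in the whole sequence space, since truncations need not stay in the
   subspace. *)
suff : cauchy_along F (fun x => cs_val (U x)) by move/(_ e e0).
apply: cauchy_along_approx => {e0}e e0.
have [N hN] := @weight_small nu (e / C) (ltac:(by rewrite nu0)) (divr_gt0 e0 C0).
exists (fun x => \sum_(i < N) (cs_coord i (U x) : K) *: ell_delta i).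
exists [set x | rnorm x <= 1]; split => //.
  apply: (@ultra_rank_cauchy _ _ _ _ _ _ _ _ _ D FU FB) => i x /= x1.
  apply: le_trans (cs_coord_le _ _) _; apply: le_trans (hD x) _.
  by rewrite ler_piMr.
move=> x /= x1.
pose y m : K^o := if (m < N)%N then 0 else cs_coord m x.
rewrite -lee_fin ell_rnormE.
have -> : ((cs_val (U x) - \sum_(i < N) (cs_coord i (U x) : K) *: ell_delta i :
    ell k q1) : nat -> K^o) = fun m => sofR k (weight (b / a) m) *: y m.
  apply/funext => m; set z := \sum_(i < N) _.
  transitivity (cs_coord m (U x) - z m); first by [].
  have -> : z m = \sum_(i < N) (cs_coord i (U x) : K) * (m == i)%:R.
    by rewrite /z ell_coord_sum.
  rewrite /y; case: ltnP => [mN|Nm].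
    rewrite scaler0 (bigD1 (Ordinal mN))//= eqxx mulr1 big1 ?addr0 ?subrr// => i im.
    by rewrite (_ : (m == i) = false) ?mulr0//; apply/negbTE; rewrite eq_sym.
  rewrite big1 ?subr0 ?Uc// => i _.
  by rewrite gtn_eqF ?mulr0// (leq_trans (ltn_ord i)).
apply: (@lnorm_embedding R k p q p1 q1 a b a_gt0 b_gt0 b_small); first exact: ltW.
rewrite -[e]mulr1; apply: kal => //; first exact: ltW.
  apply: (@le_trans _ _ (lnorm p (cs_val x))); last by rewrite -ell_rnormE lee_fin.
  apply: le_lnorm => // m; rewrite /y; case: ifP => // _.
  by rewrite rnorm0 rnorm_ge0.
move=> m; rewrite /y; case: ltnP => [|Nm]; [by left|right].
by rewrite mulrC -ler_pdivlMr// hN.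
Qed.

End QuasiNuclear.

(** * Choice of the exponents *)

Section Exponents.
Context {R : realType}.

Lemma powR2_lt (x y : R) : x < y -> 2 `^ x < 2 `^ y.
Proof.
move=> xy; rewrite /powR gt_eqF// ltr_expR ltr_pM2r// ln_gt0//.
by rewrite ltr1n.
Qed.

Lemma powR2D (x y : R) : 2 `^ (x + y) = 2 `^ x * 2 `^ y.
Proof. by rewrite powRD// pnatr_eq0 implybT. Qed.

Lemma powR2_0 : 2 `^ 0 = 1 :> R. Proof. exact: powRr0. Qed.
Lemma powR2_1 : 2 `^ 1 = 2 :> R. Proof. by rewrite powRr1. Qed.
Lemma powR2_2 : 2 `^ 2 = 4 :> R.
Proof. by rewrite powR_mulrn// expr2 -natrM. Qed.

Lemma powR4 (x : R) : 4 `^ x = 2 `^ (2 * x).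
Proof. by rewrite powRrM powR2_2. Qed.

Lemma powR2_succ (x : R) : 2 * 2 `^ x = 2 `^ (1 + x).
Proof. by rewrite powR2D powR2_1. Qed.

(** The exponent of b lies midway between -1 and -2/s, so 2 b > 1 and 4 b^s < 1. The value 1/r = 1/8
    - 1/(4 s) makes 4^(1/r) the square root of 2 b. *)
Lemma target_exponent (s : R) : 2 < s ->
  4 * (2 `^ (- (2^-1 + s^-1))) `^ s < 1 /\
  4 `^ (8^-1 - s^-1 / 4) < 2 * 2 `^ (- (2^-1 + s^-1)).
Proof.
move=> s2; have s0 : 0 < s by lra.
have si : s^-1 < 2^-1 by rewrite ltf_pV2 ?posrE.
split; last by rewrite powR4 powR2_succ powR2_lt//; lra.
have -> : 4 * (2 `^ (- (2^-1 + s^-1))) `^ s = 2 `^ (1 - s / 2).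
  have -> : 1 - s / 2 = 2 + - (2^-1 + s^-1) * s by field; rewrite gt_eqF.
  by rewrite powR2D powR2_2 powRrM.
by rewrite -[ltRHS]powR2_0 powR2_lt//; lra.
Qed.

Lemma source_exponent (s p : R) : 2 < s -> 0 < p ->
  exists t, [/\ 0 <= t, (2 `^ (- (2^-1 + s^-1))) `^ (s / p) < 2 `^ (- t) &
    4 `^ p^-1 * 2 `^ (- t) < 2 * 2 `^ (- (2^-1 + s^-1))].
Proof.
move=> s2 p0; have s0 : 0 < s by lra.
have si : s^-1 < 2^-1 by rewrite ltf_pV2 ?posrE.
have u0 : 0 < p^-1 by rewrite invr_gt0.
have su : 0 < (s - 2) * p^-1 by rewrite mulr_gt0// subr_gt0.
have sp0 : 0 < s * p^-1 by rewrite mulr_gt0.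
have csp : - (2^-1 + s^-1) * (s / p) = - (2^-1 * (s * p^-1) + p^-1).
  by field; rewrite !gt_eqF.
rewrite mulrBl in su; rewrite -powRrM csp.
(* The midpoint of the interval allowed by the two inequalities, which is nonempty as s > 2. Its
   upper end is positive, so replacing [t0] by its maximum with 0 keeps both and gives a <= 1. *)
pose t0 := ((2^-1 * (s * p^-1) + p^-1) + (s^-1 - 2^-1 + 2 * p^-1)) / 2.
have m0 : 0 <= Num.max 0 t0 by rewrite le_max lexx.
have mt : t0 <= Num.max 0 t0 by rewrite le_max lexx orbT.
exists (Num.max 0 t0); split => //.
  rewrite powR2_lt// ltrN2 gt_max /t0; apply/andP; split; lra.
rewrite powR4 -powR2D powR2_succ powR2_lt//.
move: mt; rewrite {1}/t0; lra.
Qed.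

End Exponents.

(** * Both inclusions into one target space *)

Theorem theorem3p9 (R : realType) (k : scalar_kind) (p q : R)
    (hp : 2 < p) (hq : 2 < q) (hpq : p <> q) :
  exists Y : closedSubspace (ell k (lt2_le1 hq)),
    ~ uniform_AP (fun Z W => quasi_nuclear p Z W) Y /\
    exists X : closedSubspace (ell k (lt2_le1 hp)),
      approximable X Y `<` compact_op X Y.
Proof.
set s := Num.min p q; have s2 : 2 < s by rewrite lt_min hp hq.
have p0 : 0 < p by lra.
have s0 : 0 < s by lra.
have [b_small hr] := target_exponent s2.
have [t [t0 bt ht]] := source_exponent s2 p0.
set b := 2 `^ _ in b_small hr bt ht.
have b0 : 0 < b by rewrite powR_gt0.
(* The same [Y] serves both claims and only the source changes: l^r with a = 1 for the quasi-nuclear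
   inclusion, l^p with a = 2^(-t) for the compact one. *)
exists (davie b); split.
  have si : s^-1 < 2^-1 by rewrite ltf_pV2 ?posrE.
  have si0 : 0 < s^-1 by rewrite invr_gt0.
  have r0 : 0 < 8^-1 - s^-1 / 4 by lra.
  have r1 : 1 <= (8^-1 - s^-1 / 4)^-1 by rewrite invf_ge1//; lra.
  have [U [Uqn Ub Ue]] := @quasi_nuclear_inclusion R k p q (lt2_le1 hp) (lt2_le1 hq)
    b b0 b_small _ r1.
  move=> /(_ _ U Uqn); apply: (inclusion_not_approximable ltr01 (lexx 1) b0 _ Ub Ue).
  by rewrite invrK mulr1.
have a0 : 0 < 2 `^ (- t) :> R by rewrite powR_gt0.
have a1 : 2 `^ (- t) <= 1 :> R.
  move: t0; rewrite le_eqVlt => /predU1P[<-|t0]; first by rewrite oppr0 powR2_0.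
  by rewrite -[leRHS]powR2_0 ltW// powR2_lt// oppr_lt0.
exists (davie (2 `^ (- t))); split; first exact: approximable_compact.
have [U [Uc Ub Ue]] :=
  @compact_inclusion R k p q (lt2_le1 hp) (lt2_le1 hq) _ b a0 b0 b_small bt.
move=> KA; exact: (inclusion_not_approximable a0 a1 b0 ht Ub Ue (KA U Uc)).
Qed.
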